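(* Let $\alpha\in FT_1$ and let $n<m$ be positive integers. Suppose that $\mu(n\alpha)=\mu(m\alpha)$ and let $y(z)=\int_{-\infty}^{+\infty}\frac{\mu(n\alpha)(dw)}{w-z}$ for $\Im z>0$. Then on $\{z\in\mathbb{C}:\Im z>0\}$ $$\left(\frac{y^{(n-1)}}{(n-1)!}\right)^m=\left(\frac{y^{(m-1)}}{(m-1)!}\right)^n .$$ In particular, if $m=n+1$ or if $m=n+2$, then $\alpha$ is Cauchy or Dirac.
   Context: $FT_1$ is the set of probabilities $\alpha$ on $\mathbb{R}$ with $\int\log(1+|x|)\alpha(dx)<\infty$. For $\alpha\in FT_1$ and $t>0$, let $B_1,Y_1,B_2,Y_2,\ldots$ be independent with $B_k\sim\alpha$ and $Y_k\sim\beta(1,t)$ (density $t(1-y)^{t-1}$ on $(0,1)$), and put $W_1=Y_1$, $W_k=Y_k(1-Y_{k-1})\cdots(1-Y_1)$ for $k>1$. The series $X_t=\sum_{k\ge1}W_kB_k$ converges absolutely almost surely, and $\mu(t\alpha)$ denotes its distribution (it is the law of $\int x\,P_t(dx)$ for a Dirichlet random probability $P_t=\sum_k W_k\delta_{B_k}\sim\mathcal{D}(t\alpha)$). ''Cauchy'' means $\alpha(dx)=\frac1\pi\frac{b\,dx}{(x-a)^2+b^2}$ for some $a\in\mathbb{R}$, $b>0$; ''Dirac'' means $\alpha=\delta_a$ for some $a\in\mathbb{R}$. *)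

(* Defs.v *)
From HB Require Import structures.
From mathcomp Require Import all_boot all_order all_algebra.
From mathcomp Require Import all_classical all_reals all_analysis.
From mathcomp Require Export complex.
Set Implicit Arguments.
Unset Strict Implicit.
Unset Printing Implicit Defensive.
Import Order.TTheory GRing.Theory Num.Theory.
Import numFieldNormedType.Exports.
Local Open Scope classical_set_scope.
Local Open Scope ring_scope.

(* Probabilities on the Borel sigma-algebra of R. Two of them are "equal" when
   they agree on measurable sets: a [probability] is a function on all subsets,
   whose values outside the sigma-algebra are meaningless. *)
Definition eq_prob (R : realType) (p q : probability (measurableTypeR R) R) :=
  forall A : set R, measurable A -> p A = q A.

Definition FT1 (R : realType) (alpha : probability (measurableTypeR R) R) :=
  (\int[alpha]_x (ln (1 + `|x|))%:E < +oo)%E.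

Definition has_density (R : realType) (p : probability (measurableTypeR R) R)
    (f : R -> R) :=
  forall A : set R, measurable A ->
    p A = (\int[@lebesgue_measure R]_(x in A) (f x)%:E)%E.

Definition beta1_pdf (R : realType) (t : R) (y : R) : R :=
  if (0 < y) && (y < 1) then t * (1 - y) `^ (t - 1) else 0.

Definition is_cauchy (R : realType) (p : probability (measurableTypeR R) R) :=
  exists a b : R, 0 < b /\
    has_density p (fun x => pi^-1 * (b / ((x - a) ^+ 2 + b ^+ 2))).

Definition is_dirac (R : realType) (p : probability (measurableTypeR R) R) :=
  exists a : R, forall A : set R, measurable A -> p A = (\d_a A)%E.

(* Mutual independence: the product rule over every finite subfamily. *)
Definition mutually_independent d (Omega : measurableType d) (R : realType)
    (P : probability Omega R) (I : eqType) (X : I -> Omega -> R) :=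
  forall (s : seq I) (A : I -> set R), uniq s ->
    (forall i, measurable (A i)) ->
    P [set w | forall i, i \in s -> A i (X i w)] =
    (\prod_(i <- s) P (X i @^-1` A i))%E.

(* Indices start at 0, so [stick Y k] is the weight usually written
   W_(k+1) = Y_(k+1) (1 - Y_k) ... (1 - Y_1). *)
Definition stick (R : realType) (Y : nat -> R) (k : nat) : R :=
  Y k * \prod_(j < k) (1 - Y j).

(* [is_mu t alpha nu]: nu is the law mu(t alpha) of the random series
   X_t = \sum_k W_k B_k. That law does not depend on the choice of the
   probability space carrying the sequences B and Y. *)
Definition is_mu (R : realType) (t : R)
    (alpha nu : probability (measurableTypeR R) R) : Prop :=
  exists (d : measure_display) (Omega : measurableType d)
    (P : probability Omega R)
    (B Y : nat -> {RV P >-> measurableTypeR R})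
    (X : {RV P >-> measurableTypeR R}),
  [/\ mutually_independent P
        (fun i : nat + nat =>
           match i with inl k => B k : Omega -> R | inr k => Y k end),
      forall k, eq_prob (distribution P (B k)) alpha,
      forall k, has_density (distribution P (Y k)) (beta1_pdf t),
      {ae P, forall w,
        series (fun k => stick (fun j => (Y j : Omega -> R) w) k * B k w : R)
          @ \oo --> (X w : R)}
    & eq_prob nu (distribution P X)].

Definition cintegral (R : realType) (p : probability (measurableTypeR R) R)
    (f : R -> R[i]) : R[i] :=
  Complex (Rintegral p setT (fun w => complex.Re (f w)))
          (Rintegral p setT (fun w => complex.Im (f w))).

Definition stieltjes (R : realType) (p : probability (measurableTypeR R) R)
    (z : R[i]) : R[i] :=
  cintegral p (fun w : R => (real_complex R w - z)^-1).

(* Iterated complex derivative: the scalar field of [derive1n] is R[i]. *)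
Definition cderive (R : realType) (k : nat) (f : R[i] -> R[i]) : R[i] -> R[i] :=
  derive1n k (f : R[i] -> R[i]^o).

(* Main.v *)
(** For an independent copy [X'] of [X_t], with [B] of law [alpha] and [Y] of law
    [beta(1, t)], the stick-breaking series gives [X_t = Y B + (1 - Y) X'] in law.
    Since [E ((1 - Y) p + Y q)^-(t+1) = p^-t q^-1], this yields
    [phi_(t+1) = phi_t S] for [t = n, m], where [phi_k z] is the integral of
    [(w - z)^-k] against [mu(n alpha) = mu(m alpha)] and [S] is the Stieltjes
    transform of [alpha].  As [phi_k' = k phi_(k+1)], both [phi_n ^ m] and
    [phi_m ^ n] solve [u' = n m S u]; they do not vanish (Gronwall, using
    [|S z| <= 1 / Im z]) and they agree asymptotically at [i oo], so they are
    equal.  If [m] is [n + 1] or [n + 2], eliminating [phi_n] gives [S' = S ^ 2],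
    hence [S z = 1 / (c - z)] with [Im c <= 0], and inverting the Stieltjes
    transform shows that [alpha] is Dirac ([Im c = 0]) or Cauchy ([Im c < 0]). *)

Require Import Defs.
From HB Require Import structures.
From mathcomp Require Import all_boot all_order all_algebra.
From mathcomp Require Import all_classical all_reals all_analysis.
From mathcomp Require Import measurable_realfun ring lra.
Set Implicit Arguments.
Unset Strict Implicit.
Unset Printing Implicit Defensive.
Import Order.TTheory GRing.Theory Num.Theory.
Import numFieldNormedType.Exports.
Import ComplexField.Normc.
Local Open Scope classical_set_scope.
Local Open Scope ring_scope.
Local Open Scope complex_scope.

(** * Complex derivatives *)

(** The limit [X_t] itself is never decomposed. A truncated sum satisfies exactly
    [X_(N+1) = Y B + (1 - Y) X'_N], where the shifted sum [X'_N] of [N] terms is independent of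
    [(Y, B)] and distributed as [X_N]. So the Markov-Krein identity links stage [N + 1] to stage
    [N], and both sides converge. Since [(w - z)^-k] is bounded by [(Im z)^-k], all complex
    integrals are integrals of bounded functions.

    Logarithms or roots of [phi_n] would require a choice of branch. The relation is therefore kept
    between integer powers, and its only constant is read off from [y^k phi_k(x + i y) -> i^k]. The
    same limit excludes zeros: a zero would propagate up its whole vertical line. For [m = n + 1]
    the power relation simplifies to [phi_n = S^n]; for [m = n + 2] the one-step relations are
    differentiated instead.

    Atoms of [alpha] are not excluded in advance, so for the Cauchy law the inversion formula is
    used as a pair of inequalities between masses of open and closed intervals. In the Dirac case
    one value of [S] is enough. *)

Section ComplexBasics.
Variable R : realType.
Implicit Types z w : R[i].

Lemma normc_ge0 z : 0 <= normc z.
Proof. by case: z => a b; rewrite sqrtr_ge0. Qed.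

Lemma ltc_normcP z (e : R) : (`|z| < e%:C) = (normc z < e).
Proof. by rewrite -ltcR. Qed.

Lemma gt0_complexP z : 0 < z -> exists2 e : R, 0 < e & z = e%:C.
Proof.
by case: z => a b; rewrite ltcE /= => /andP[/eqP -> a0]; exists a.
Qed.

Lemma normr_Re_le z : `|complex.Re z| <= normc z.
Proof. by rewrite -lecR; exact: normc_ge_Re. Qed.

Lemma normr_Im_le z : `|complex.Im z| <= normc z.
Proof.
by case: z => a b /=; rewrite -sqrtr_sqr ler_wsqrtr// lerDr sqr_ge0.
Qed.

Lemma normc_le_ReIm z : normc z <= `|complex.Re z| + `|complex.Im z|.
Proof.
rewrite {1}[z]complexE; apply: le_trans (le_normcD _ _) _.
by rewrite normcM /= !expr0n /= !addr0 !add0r expr1n sqrtr1 mul1r !sqrtr_sqr.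
Qed.

Lemma normcX z n : normc (z ^+ n) = normc z ^+ n.
Proof. by elim: n => [|n IH]; rewrite ?expr0 ?normc1// !exprS normcM IH. Qed.

Lemma normc_eq0 z : (normc z == 0) = (z == 0).
Proof. by apply/eqP/eqP => [/eq0_normc//|->]; rewrite /normc /= expr0n addr0 sqrtr0. Qed.

Lemma normc_real (x : R) : normc x%:C = `|x|.
Proof. by rewrite /= expr0n /= addr0 sqrtr_sqr. Qed.

Lemma cvg_complexP (T : Type) (F : set_system T) (FF : Filter F)
    (f : T -> R[i]) (l : R[i]) :
  ((f : T -> R[i]^o) @ F --> (l : R[i]^o)) <->
  (complex.Re (f x) @[x --> F] --> complex.Re l /\
   complex.Im (f x) @[x --> F] --> complex.Im l).
Proof.
split=> [/cvgrPdist_lt h|[/cvgrPdist_lt hr /cvgrPdist_lt hi]].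
  split; apply/cvgrPdist_lt => e e0.
    have := h e%:C; rewrite ltcR => /(_ e0); apply: filterS => x.
    rewrite ltc_normcP; apply: le_lt_trans.
    by rewrite -[X in `|X|](raddfB (@complex.Re R : Rcomplex R -> R)); exact: normr_Re_le.
  have := h e%:C; rewrite ltcR => /(_ e0); apply: filterS => x.
  rewrite ltc_normcP; apply: le_lt_trans.
  by rewrite -[X in `|X|](raddfB (@complex.Im R : Rcomplex R -> R)); exact: normr_Im_le.
apply/cvgrPdist_lt => e /gt0_complexP[{}e e0 ->].
have e20 : 0 < e / 2 by rewrite divr_gt0.
near=> x; rewrite ltc_normcP; apply: le_lt_trans (normc_le_ReIm _) _.
rewrite (raddfB (@complex.Re R : Rcomplex R -> R)) (raddfB (@complex.Im R : Rcomplex R -> R)).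
rewrite [ltRHS]splitr ltrD//.
- by near: x; exact: hr.
- by near: x; exact: hi.
Unshelve. all: by end_near. Qed.

(** Restated for maps into [R[i]], because the normed structure of the field over itself is carried
    by the alias [R[i]^o]. The next limit lemmas serve the same purpose. *)
Lemma ccvgM (T : Type) (F : set_system T) {FF : Filter F} (f g : T -> R[i]) (a b : R[i]) :
  ((f : T -> R[i]^o) @ F --> (a : R[i]^o)) ->
  ((g : T -> R[i]^o) @ F --> (b : R[i]^o)) ->
  (((fun x => f x * g x) : T -> R[i]^o) @ F --> (a * b : R[i]^o)).
Proof. exact: (@cvgM R[i] T F FF f g a b). Qed.

Lemma ccvgX (T : Type) (F : set_system T) {FF : Filter F} (f : T -> R[i]) (a : R[i]) n :
  ((f : T -> R[i]^o) @ F --> (a : R[i]^o)) ->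
  (((fun x => f x ^+ n) : T -> R[i]^o) @ F --> (a ^+ n : R[i]^o)).
Proof.
move=> fa; elim: n => [|n IH]; first exact: cvg_cst.
rewrite exprS (_ : (fun x => _) = fun x => f x * f x ^+ n); first exact: ccvgM.
by apply/funext => x; rewrite exprS.
Qed.

Lemma ccvgV (T : Type) (F : set_system T) {FF : Filter F} (f : T -> R[i]) (a : R[i]) :
  a != 0 -> ((f : T -> R[i]^o) @ F --> (a : R[i]^o)) ->
  (((fun x => (f x)^-1) : T -> R[i]^o) @ F --> (a^-1 : R[i]^o)).
Proof. exact: (@cvgV R[i] T F FF f a). Qed.

Lemma ccvg_unique (T : Type) (F : set_system T) {FF : ProperFilter F} (f : T -> R[i])
    (a b : R[i]) :
  ((f : T -> R[i]^o) @ F --> (a : R[i]^o)) ->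
  ((f : T -> R[i]^o) @ F --> (b : R[i]^o)) -> a = b.
Proof. exact: (@cvg_unique R[i]^o (@norm_hausdorff _ _)). Qed.

Lemma ccvg_shiftS (f : nat -> R[i]) (a : R[i]) :
  ((f : nat -> R[i]^o) @ \oo --> (a : R[i]^o)) ->
  (((fun n => f n.+1) : nat -> R[i]^o) @ \oo --> (a : R[i]^o)).
Proof. 
have H (T : ptopologicalType) (g : nat -> T) (b : T) : g @ \oo --> b -> g n.+1 @[n --> \oo] --> b.
  by rewrite -(cvg_shiftS g).
exact: (H R[i]^o).
Qed.

(** The scalar field is [R[i]], so a derivative in direction [1] is a genuine complex derivative;
    this also matches [derive1n] in [cderive]. *)
Definition cder (f : R[i] -> R[i]) (z d : R[i]) :=
  is_derive (z : R[i]^o) (1 : R[i]^o) (f : R[i]^o -> R[i]^o) d.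

Lemma cder_eq f z d d' : cder f z d -> d = d' -> cder f z d'.
Proof. by move=> h <-. Qed.

Lemma cder_cst c z : cder (fun=> c) z 0.
Proof. exact: is_derive_cst. Qed.

Lemma cder_id z : cder id z 1.
Proof. exact: is_derive_id. Qed.

Lemma cderD f g z df dg : cder f z df -> cder g z dg ->
  cder (fun w => f w + g w) z (df + dg).
Proof. by move=> hf hg; exact: is_deriveD. Qed.

Lemma cderB f g z df dg : cder f z df -> cder g z dg ->
  cder (fun w => f w - g w) z (df - dg).
Proof. by move=> hf hg; exact: is_deriveB. Qed.

Lemma cderM f g z df dg : cder f z df -> cder g z dg ->
  cder (fun w => f w * g w) z (f z * dg + g z * df).
Proof. by move=> hf hg; exact: is_deriveM. Qed.

Lemma cderX f n z df : cder f z df ->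
  cder (fun w => f w ^+ n) z (n%:R * f z ^+ n.-1 * df).
Proof.
elim: n => [|n IH] hf.
  by apply: cder_eq (cder_cst _ _) _; rewrite !mul0r.
case: n IH => [|n] IH.
  by apply: cder_eq hf _; rewrite expr0 !mul1r.
rewrite [X in cder X _ _](_ : _ = fun w => f w * f w ^+ n.+1); last first.
  by apply/funext => w; rewrite exprS.
apply: cder_eq (cderM hf (IH hf)) _.
by rewrite /= [n.+2%:R]mulrS !exprS; ring.
Qed.

(** A power multiplies the logarithmic derivative by its exponent; the form without division also
    covers zeros of [f]. *)
Lemma cderX_log f n z a : cder f z (a * f z) ->
  cder (fun w => f w ^+ n) z (n%:R * a * f z ^+ n).
Proof.
move=> /(cderX n) /cder_eq; apply; case: n => [|n]; first by rewrite !mul0r.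
by rewrite /= exprS; ring.
Qed.

Lemma cderV f z df : f z != 0 -> cder f z df ->
  cder (fun w => (f w)^-1) z (- (f z) ^- 2 * df).
Proof.
move=> f0 [h1 h2]; apply: DeriveDef.
  exact: (@derivableV _ _ (f : R[i]^o -> R[i]^o)).
by rewrite (@deriveV _ _ (f : R[i]^o -> R[i]^o))// h2.
Qed.

(** A quadratic remainder bound is preserved by integration, so this criterion is what
    differentiates under the integral sign. *)
Lemma cder_quadratic f z d (C del : R) : 0 < del ->
  (forall w, normc (w - z) < del ->
     normc (f w - f z - (w - z) * d) <= C * normc (w - z) ^+ 2) ->
  cder f z d.
Proof.
move=> del0 H.
have C0 : 0 <= `|C| + 1 by rewrite addr_ge0.
have cv : (h^-1 *: ((f \o shift z) (h *: (1 : R[i]^o)) - f z) : R[i]^o)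
    @[h --> (0 : R[i]^o)^'] --> (d : R[i]^o).
  apply/cvgrPdist_lt => e /gt0_complexP[{}e e0 ->].
  (* [C] may be zero or negative, hence the divisor [|C| + 1]. *)
  have m0 : 0 < Num.min del (e / (`|C| + 1)).
    by rewrite lt_min del0 divr_gt0// ltr_wpDl.
  exists (Num.min del (e / (`|C| + 1)))%:C => /=; first by rewrite ltcR.
  move=> h; rewrite /ball_ /= sub0r ltc_normcP normcN lt_min => /andP[h1 h2] h0.
  have hn0 : 0 < normc h by rewrite lt_neqAle eq_sym normc_eq0 h0 normc_ge0.
  rewrite /shift /= /GRing.scale /= mulr1.
  have := H (h + z); rewrite addrK => /(_ h1) Hh.
  rewrite ltc_normcP.
  rewrite (_ : d - _ = - h^-1 * (f (h + z) - f z - h * d)); last first.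
    by field.
  rewrite normcM normcN normcV mulrC ltr_pdivrMr//.
  apply: le_lt_trans Hh _; rewrite expr2 mulrA ltr_pM2r//.
  rewrite (@le_lt_trans _ _ ((`|C| + 1) * normc h))//.
    by rewrite ler_wpM2r ?normc_ge0// (le_trans (ler_norm _))// lerDl.
  by rewrite mulrC -ltr_pdivlMr// ltr_wpDl.
apply: DeriveDef; first by apply/cvg_ex; exists d.
by apply: cvg_lim cv.
Qed.

(** Chain rule along a real line in the plane. It brings complex derivatives within reach of the
    real mean value theorem, of monotonicity and of the fundamental theorem of calculus. *)
Lemma cder_line f z e t d : cder f (z + t%:C * e) d ->
  is_derive t 1 (fun s : R => complex.Re (f (z + s%:C * e))) (complex.Re (e * d)) /\
  is_derive t 1 (fun s : R => complex.Im (f (z + s%:C * e))) (complex.Im (e * d)).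
Proof.
move=> [df dd].
have cv : (h^-1 *: ((f \o shift (z + t%:C * e)) (h *: (1 : R[i]^o)) - f (z + t%:C * e)) : R[i]^o)
    @[h --> (0 : R[i]^o)^'] --> (d : R[i]^o).
  by rewrite -dd; exact: df.
have H : ((h^-1)%:C * (f (z + (h + t)%:C * e) - f (z + t%:C * e)) : R[i]^o)
   @[h --> (0 : R)^'] --> (e * d : R[i]^o).
  (* The complex limit is taken over nonzero increments, and [h e] is one only if [e] is nonzero. *)
  have [->|e0] := eqVneq e 0.
    under eq_fun do rewrite !mulr0 subrr mulr0.
    by rewrite mul0r; exact: cvg_cst.
  apply/cvgrPdist_lt => eps /gt0_complexP[{}eps eps0 ->].
  have ne0 : 0 < normc e by rewrite lt_neqAle eq_sym normc_eq0 e0 normc_ge0.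
  move/cvgrPdist_lt : cv => /(_ (eps / normc e)%:C).
  rewrite ltcR divr_gt0// => /(_ isT)[del' /= /gt0_complexP[del del0 ->]] Hd.
  exists (del / normc e) => /=; first by rewrite divr_gt0.
  move=> h; rewrite /ball_ /= sub0r normrN ltr_pdivlMr// => h1 h0.
  have hC0 : h%:C != 0 by apply: contra h0 => /eqP[->].
  have := Hd (h%:C * e); rewrite /ball_ /= sub0r ltc_normcP normcN normcM normc_real.
  move=> /(_ h1); rewrite mulf_neq0// => /(_ isT).
  rewrite /shift /= /GRing.scale /= mulr1 !ltc_normcP ltr_pdivlMr// => h2.
  rewrite [X in normc X](_ : _ = (d - (h%:C * e)^-1 *
    (f (h%:C * e + (z + t%:C * e)) - f (z + t%:C * e))) * e) ?normcM//.
  rewrite fmorphV rmorphD /= (_ : h%:C * e + _ = z + (h%:C + t%:C) * e); last by ring.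
  by field; rewrite e0 hC0.
have [Hr Hi] := (cvg_complexP _ _ _).1 H.
have Ree : forall (r : R) w, complex.Re (r%:C * w) = r * complex.Re w.
  by move=> r [a b] /=; rewrite mul0r subr0.
have Ime : forall (r : R) w, complex.Im (r%:C * w) = r * complex.Im w.
  by move=> r [a b] /=; rewrite mul0r addr0.
split.
- have cr : h^-1 *: (((fun s => complex.Re (f (z + s%:C * e))) \o shift t) (h *: 1) -
      complex.Re (f (z + t%:C * e))) @[h --> (0:R)^'] --> complex.Re (e * d).
    apply: cvg_trans Hr; apply: near_eq_cvg; near=> h.
    by rewrite Ree (raddfB (@complex.Re R : Rcomplex R -> R)) /= /shift /= /GRing.scale /= mulr1.
  by apply: DeriveDef; [apply/cvg_ex; eexists; exact: cr|exact: cvg_lim cr].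
- have cr : h^-1 *: (((fun s => complex.Im (f (z + s%:C * e))) \o shift t) (h *: 1) -
      complex.Im (f (z + t%:C * e))) @[h --> (0:R)^'] --> complex.Im (e * d).
    apply: cvg_trans Hi; apply: near_eq_cvg; near=> h.
    by rewrite Ime (raddfB (@complex.Im R : Rcomplex R -> R)) /= /shift /= /GRing.scale /= mulr1.
  by apply: DeriveDef; [apply/cvg_ex; eexists; exact: cr|exact: cvg_lim cr].
Unshelve. all: by end_near. Qed.

End ComplexBasics.

(** * Integrals of bounded complex functions *)

Section ComplexIntegral.
Context d (T : measurableType d) (R : realType).
Implicit Types (P : probability T R) (f g : T -> R[i]).

Definition cmeas f := measurable_fun [set: T] (fun x => complex.Re (f x)) /\
  measurable_fun [set: T] (fun x => complex.Im (f x)).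

Definition cbounded (M : R) f := forall x, normc (f x) <= M.

(** [cintegral] over an arbitrary probability space: it is also needed on [Omega] and on
    products. *)
Definition cint P f : R[i] :=
  Complex (Rintegral P setT (fun x => complex.Re (f x)))
          (Rintegral P setT (fun x => complex.Im (f x))).

Lemma cmeas_cst c : cmeas (fun=> c).
Proof. by split; exact: measurable_cst. Qed.

Lemma cmeas_real (h : T -> R) : measurable_fun setT h -> cmeas (fun x => (h x)%:C).
Proof. by move=> mh; split => //; exact: measurable_cst. Qed.

Lemma cmeasD f g : cmeas f -> cmeas g -> cmeas (fun x => f x + g x).
Proof.
move=> [fr fi] [gr gi]; split.
- rewrite (_ : (fun x => _) = (fun x => complex.Re (f x)) \+ (fun x => complex.Re (g x))).
    exact: measurable_funD.
  by apply/funext => x; rewrite (raddfD (@complex.Re R : Rcomplex R -> R)).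
- rewrite (_ : (fun x => _) = (fun x => complex.Im (f x)) \+ (fun x => complex.Im (g x))).
    exact: measurable_funD.
  by apply/funext => x; rewrite (raddfD (@complex.Im R : Rcomplex R -> R)).
Qed.

Lemma ReM (a b : R[i]) :
  complex.Re (a * b) = complex.Re a * complex.Re b - complex.Im a * complex.Im b.
Proof. by case: a b => [? ?] [? ?]. Qed.

Lemma ImM (a b : R[i]) :
  complex.Im (a * b) = complex.Re a * complex.Im b + complex.Im a * complex.Re b.
Proof. by case: a b => [? ?] [? ?]. Qed.

Lemma cmeasM f g : cmeas f -> cmeas g -> cmeas (fun x => f x * g x).
Proof.
move=> [fr fi] [gr gi]; split.
- under eq_fun do rewrite ReM.
  by apply: measurable_funB; exact: measurable_funM.
- under eq_fun do rewrite ImM.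
  by apply: measurable_funD; exact: measurable_funM.
Qed.

Lemma cmeasX f n : cmeas f -> cmeas (fun x => f x ^+ n).
Proof.
move=> mf; elim: n => [|n IH]; first exact: cmeas_cst.
under eq_fun do rewrite exprS.
exact: cmeasM.
Qed.

Lemma cmeasV f : cmeas f -> cmeas (fun x => (f x)^-1).
Proof.
move=> [fr fi].
have mi : measurable_fun [set: T]
    (fun x => (complex.Re (f x) ^+ 2 + complex.Im (f x) ^+ 2)^-1).
  (* Inversion is the real power [-1]; both are [0] at [0], so zeros of [f] do no harm. *)
  under eq_fun do rewrite -powR_inv1 ?addr_ge0 ?sqr_ge0//.
  apply: (measurableT_comp (measurable_powR (-1))).
  by apply: measurable_funD; exact: measurable_funX.
split.
- rewrite (_ : (fun x => _) = (fun x => complex.Re (f x) *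
    (complex.Re (f x) ^+ 2 + complex.Im (f x) ^+ 2)^-1)).
    exact: measurable_funM.
  by apply/funext => x; case: (f x).
- rewrite (_ : (fun x => _) = (fun x => - (complex.Im (f x) *
    (complex.Re (f x) ^+ 2 + complex.Im (f x) ^+ 2)^-1))).
    by apply: measurable_funN; exact: measurable_funM.
  by apply/funext => x; case: (f x).
Qed.

Lemma cmeasB f g : cmeas f -> cmeas g -> cmeas (fun x => f x - g x).
Proof.
move=> mf mg; under eq_fun do rewrite -mulN1r.
by apply: cmeasD => //; apply: cmeasM => //; exact: cmeas_cst.
Qed.

Lemma cboundedB f g M N : cbounded M f -> cbounded N g ->
  cbounded (M + N) (fun x => f x - g x).
Proof.
move=> bf bg x; apply: le_trans (le_normcD _ _) _.
by rewrite normcN lerD.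
Qed.

Lemma cboundedZ f c M : cbounded M f -> cbounded (normc c * M) (fun x => c * f x).
Proof. by move=> bf x; rewrite normcM ler_wpM2l// normc_ge0. Qed.

Lemma bounded_integrable P (h : T -> R) M : measurable_fun setT h ->
  (forall x, `|h x| <= M) -> P.-integrable setT (EFin \o h).
Proof.
move=> mh bh; apply: measurable_bounded_integrable => //.
  by rewrite (le_lt_trans (probability_le1 P measurableT))// ltry.
exists M; split; first exact: num_real.
by move=> N MN x _ /=; apply: (le_trans (bh x)); exact: ltW.
Qed.

Lemma cRe_integrable P f M : cmeas f -> cbounded M f ->
  P.-integrable setT (EFin \o (fun x => complex.Re (f x))).
Proof.
move=> [fr _] b; apply: (@bounded_integrable _ _ M) => // x.
exact: le_trans (normr_Re_le _) (b x).
Qed.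

Lemma cIm_integrable P f M : cmeas f -> cbounded M f ->
  P.-integrable setT (EFin \o (fun x => complex.Im (f x))).
Proof.
move=> [_ fi] b; apply: (@bounded_integrable _ _ M) => // x.
exact: le_trans (normr_Im_le _) (b x).
Qed.

Lemma eq_cint P f g : f =1 g -> cint P f = cint P g.
Proof. by move=> /funext ->. Qed.

Lemma cint_cst P c : cint P (fun=> c) = c.
Proof.
rewrite /cint !Rintegral_cst//= probability_setT /= !mulr1.
by case: c.
Qed.

Lemma cintD P f g M N : cmeas f -> cbounded M f -> cmeas g -> cbounded N g ->
  cint P (fun x => f x + g x) = cint P f + cint P g.
Proof.
move=> mf bf mg bg; rewrite /cint.
have := RintegralD measurableT (cRe_integrable P mf bf) (cRe_integrable P mg bg).
have := RintegralD measurableT (cIm_integrable P mf bf) (cIm_integrable P mg bg).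
move=> hi hr; rewrite -[RHS]/(Complex _ _) -hi -hr; congr (Complex _ _).
- by apply: eq_Rintegral => x _; rewrite (raddfD (@complex.Re R : Rcomplex R -> R)).
- by apply: eq_Rintegral => x _; rewrite (raddfD (@complex.Im R : Rcomplex R -> R)).
Qed.

Lemma cintZ P f c M : cmeas f -> cbounded M f ->
  cint P (fun x => c * f x) = c * cint P f.
Proof.
move=> mf bf; rewrite /cint.
have iR := cRe_integrable P mf bf; have iI := cIm_integrable P mf bf.
have iZ (r : R) h : P.-integrable setT (EFin \o h) ->
    P.-integrable setT (EFin \o (fun x => r * h x)).
  by move=> ih; exact: (integrableZl measurableT r ih).
case: c => a b; rewrite -[RHS]/(Complex _ _); congr (Complex _ _).
- rewrite -!RintegralZl// -RintegralB//; [|exact: iZ|exact: iZ].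
  by apply: eq_Rintegral => x _; rewrite ReM.
- rewrite -!RintegralZl// -RintegralD//; [|exact: iZ|exact: iZ].
  by apply: eq_Rintegral => x _; rewrite ImM.
Qed.

Lemma cintB P f g M N : cmeas f -> cbounded M f -> cmeas g -> cbounded N g ->
  cint P (fun x => f x - g x) = cint P f - cint P g.
Proof.
move=> mf bf mg bg.
have mN : cmeas (fun x => -1 * g x) by apply: cmeasM => //; exact: cmeas_cst.
have bN := cboundedZ (-1) bg.
rewrite -mulN1r -(cintZ P (-1) mg bg) -(cintD P mf bf mN bN).
by apply: eq_cint => x; rewrite mulN1r.
Qed.

(* Rotating so that the integral becomes a nonnegative real gives the sharp
   constant. *)
Lemma cbounded_cint P f M : cmeas f -> cbounded M f -> normc (cint P f) <= M.
Proof.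
move=> mf bf; set I := cint P f.
have [I0|I0] := eqVneq I 0.
  rewrite I0 /normc /= expr0n /= addr0 sqrtr0.
  (* A space of mass one has a point, and the bound at that point shows [0 <= M]. *)
  have [x _] : [set: T] !=set0.
    apply/set0P/eqP => T0; have := probability_setT P.
    by rewrite T0 measure0 => /eqP; rewrite eq_sym onee_eq0.
  exact: le_trans (normc_ge0 _) (bf x).
have nI0 : normc I != 0 by rewrite normc_eq0.
pose c := (normc I)^-1%:C * I^*.
have cI : c * I = (normc I)%:C.
  rewrite /c -mulrA [I^* * I]mulrC -sqr_normc -[`|I|]/((normc I)%:C).
  by rewrite -rmorphXn -rmorphM /=; congr (_%:C); rewrite expr2 mulKf.
have nc : normc c = 1.
  rewrite /c normcM normc_real normrV ?unitfE// ger0_norm ?normc_ge0//.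
  have -> : normc I^* = normc I by apply: complexI; exact: normcJ.
  by rewrite mulVf.
have bc : cbounded M (fun x => c * f x) by move=> x; rewrite normcM nc mul1r.
have mc : cmeas (fun x => c * f x) by apply: cmeasM => //; exact: cmeas_cst.
have : complex.Re (cint P (fun x => c * f x)) = normc I by rewrite (cintZ P c mf bf) cI.
move=> <-; rewrite /cint /=.
have -> : M = Rintegral P setT (fun=> M).
  by rewrite Rintegral_cst//= probability_setT mulr1.
apply: le_Rintegral => //.
- exact: cRe_integrable bc.
- apply: (@bounded_integrable P _ `|M|) => //.
- by move=> x _; apply: le_trans (ler_norm _) _; apply: le_trans (normr_Re_le _) (bc x).
Qed.

Lemma Rintegral_dominated_cvg P (h_ : (T -> R)^nat) (h : T -> R) (M : R) :
  (forall n, measurable_fun setT (h_ n)) -> measurable_fun setT h ->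
  (forall n x, `|h_ n x| <= M) ->
  {ae P, forall x, h_ n x @[n --> \oo] --> h x} ->
  Rintegral P setT (h_ n) @[n --> \oo] --> Rintegral P setT h.
Proof.
move=> mh_ mh b cv.
have iM : P.-integrable setT (EFin \o (fun _ : T => M)).
  by apply: (@bounded_integrable P _ `|M|).
have cv' : {ae P, forall x, [set: T] x ->
    (EFin \o h_ n) x @[n --> \oo] --> (EFin \o h) x}.
  by apply: filterS cv => x cvx _; apply: cvg_EFin; [exact: nearW|exact: cvx].
have b' : {ae P, forall x n, [set: T] x -> (`|(EFin \o h_ n) x| <= (EFin \o (fun=> M)) x)%E}.
  by apply: aeW => x n _ /=; rewrite lee_fin.
have [ih _ H] := dominated_convergence measurableT
  (fun n => (measurable_EFinP _ _).2 (mh_ n)) ((measurable_EFinP _ _).2 mh) cv' iM b'.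
apply: fine_cvg; rewrite fineK//.
exact: integrable_fin_num ih.
Qed.

Lemma cint_dominated_cvg P (f_ : (T -> R[i])^nat) f (M : R) :
  (forall n, cmeas (f_ n)) -> cmeas f -> (forall n, cbounded M (f_ n)) ->
  {ae P, forall x, (f_ n x : R[i]^o) @[n --> \oo] --> (f x : R[i]^o)} ->
  (cint P (f_ n) : R[i]^o) @[n --> \oo] --> (cint P f : R[i]^o).
Proof.
move=> mf_ mf b cv; apply/cvg_complexP; split => /=.
- apply: (@Rintegral_dominated_cvg P _ _ M).
  + by move=> n; have [] := mf_ n.
  + by have [] := mf.
  + by move=> n x; exact: le_trans (normr_Re_le _) (b n x).
  + by apply: filterS cv => x /cvg_complexP[].
- apply: (@Rintegral_dominated_cvg P _ _ M).
  + by move=> n; have [] := mf_ n.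
  + by have [] := mf.
  + by move=> n x; exact: le_trans (normr_Im_le _) (b n x).
  + by apply: filterS cv => x /cvg_complexP[].
Qed.

End ComplexIntegral.

Section ComplexIntegralTransfer.
Context d1 d2 (T1 : measurableType d1) (T2 : measurableType d2) (R : realType).

Lemma cmeas_comp (f : T2 -> R[i]) (u : T1 -> T2) :
  measurable_fun setT u -> cmeas f -> cmeas (fun x => f (u x)).
Proof.
move=> mu [fr fi]; split.
- exact: (measurableT_comp fr mu).
- exact: (measurableT_comp fi mu).
Qed.

Lemma cint_eq_measure (P Q : probability T1 R) (f : T1 -> R[i]) :
  (forall A, measurable A -> P A = Q A) -> cint P f = cint Q f.
Proof.
move=> PQ; rewrite /cint /Rintegral.
by congr (Complex (fine _) (fine _)); apply: eq_measure_integral => A mA _; exact: PQ.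
Qed.

Lemma cint_pushforward (P : probability T1 R) (Q : probability T2 R)
    (u : T1 -> T2) (f : T2 -> R[i]) (M : R) :
  measurable_fun setT u -> cmeas f -> cbounded M f ->
  (forall A, measurable A -> Q A = P (u @^-1` A)) ->
  cint Q f = cint P (fun x => f (u x)).
Proof.
move=> mu mf bf H; rewrite /cint /Rintegral.
have mfu := cmeas_comp mu mf.
have bfu : cbounded M (fun x => f (u x)) by move=> x; exact: bf.
have K (g : T2 -> R) : measurable_fun setT g ->
    P.-integrable setT (EFin \o (fun x => g (u x))) ->
    (\int[Q]_x (g x)%:E = \int[P]_x (g (u x))%:E)%E.
  move=> mg ig; rewrite (eq_measure_integral (pushforward P u)).
    rewrite integral_pushforward ?preimage_setT//.
    exact/measurable_EFinP.
  by move=> A mA _; exact: H.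
congr (Complex (fine _) (fine _)); apply: K.
- by case: mf.
- exact: cRe_integrable bfu.
- by case: mf.
- exact: cIm_integrable bfu.
Qed.

Lemma cint_fubini (P : probability T1 R) (Q : probability T2 R)
    (f : T1 * T2 -> R[i]) (M : R) : cmeas f -> cbounded M f ->
  cint (P \x Q)%E f = cint Q (fun y => cint P (fun x => f (x, y))).
Proof.
move=> mf bf; rewrite /cint /Rintegral.
have K (g : T1 * T2 -> R) : measurable_fun setT g -> (forall z, `|g z| <= M) ->
    (\int[P \x Q]_z (g z)%:E = \int[Q]_y (fine (\int[P]_x (g (x, y))%:E))%:E)%E.
  move=> mg bg; rewrite -(@integral21_prod_meas1 _ _ _ _ _ P Q (EFin \o g)).
    apply: eq_integral => y _ /=; rewrite /fubini_G /= fineK//.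
    apply: integrable_fin_num => //.
    apply: (@bounded_integrable _ _ _ P (fun x => g (x, y)) M) => //.
    exact: measurableT_comp.
  exact: (@bounded_integrable _ _ _ (P \x Q)%E g M).
congr (Complex (fine _) (fine _)); apply: K => [|z]; try by case: mf.
- exact: le_trans (normr_Re_le _) (bf z).
- exact: le_trans (normr_Im_le _) (bf z).
Qed.

Lemma cmeas_cint (P : probability T1 R) (Q : probability T2 R)
    (f : T1 * T2 -> R[i]) (M : R) :
  cmeas f -> cbounded M f -> cmeas (fun y => cint P (fun x => f (x, y))).
Proof.
move=> [mr mi] bf.
have K (g : T1 * T2 -> R) : measurable_fun setT g -> (forall z, `|g z| <= M) ->
    measurable_fun setT (fun y => Rintegral P setT (fun x => g (x, y))).
  move=> mg bg.
  have ig := @bounded_integrable _ _ _ (P \x Q)%E g M mg bg.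
  exact: measurableT_comp (fine_measurable measurableT) (measurable_fubini_G ig).
split.
- by apply: (K _ mr) => z; exact: le_trans (normr_Re_le _) (bf z).
- by apply: (K _ mi) => z; exact: le_trans (normr_Im_le _) (bf z).
Qed.

End ComplexIntegralTransfer.

(** * Derivatives of the Stieltjes transform *)

Section CauchyPowers.
Variable R : realType.
Implicit Types (p : probability (measurableTypeR R) R) (z : R[i]).

(** The function [phi_k] of the overview; for [k = 1] it is the Stieltjes transform. *)
Definition cpow p (k : nat) (z : R[i]) : R[i] :=
  cint p (fun w : R => (w%:C - z)^-1 ^+ k).

Lemma Im_le_normcB z (w : R) : complex.Im z <= normc (w%:C - z).
Proof.
apply: le_trans (normr_Im_le _); case: z => a b /=.
by rewrite sub0r normrN ler_norm.
Qed.

Lemma subz_neq0 z (w : R) : 0 < complex.Im z -> w%:C - z != 0.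
Proof.
move=> z0; rewrite -normc_eq0 gt_eqF//.
exact: lt_le_trans z0 (Im_le_normcB z w).
Qed.

Lemma normc_resolvent_le z (w v : R) : 0 < v -> v <= complex.Im z ->
  normc (w%:C - z)^-1 <= v^-1.
Proof.
move=> v0 vz; rewrite normcV lef_pV2 ?posrE//.
- exact: le_trans vz (Im_le_normcB z w).
- exact: lt_le_trans (lt_le_trans v0 vz) (Im_le_normcB z w).
Qed.

Lemma cmeas_resolvent z k : cmeas (fun w : measurableTypeR R => (w%:C - z)^-1 ^+ k).
Proof.
apply: cmeasX; apply: cmeasV; apply: cmeasD; last exact: cmeas_cst.
by apply: cmeas_real; exact: measurable_id.
Qed.

Lemma cbounded_resolvent z k : 0 < complex.Im z ->
  cbounded ((complex.Im z)^-1 ^+ k) (fun w : R => (w%:C - z)^-1 ^+ k).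
Proof.
move=> z0 w; rewrite normcX; apply: lerXn2r; rewrite ?nnegrE ?normc_ge0//.
  by rewrite invr_ge0 ltW.
exact: normc_resolvent_le.
Qed.

Lemma normc_cpow_le p k z : 0 < complex.Im z -> normc (cpow p k z) <= (complex.Im z)^-1 ^+ k.
Proof.
move=> z0; apply: cbounded_cint; first exact: cmeas_resolvent.
exact: cbounded_resolvent.
Qed.

Lemma resolvent_pow_taylor (r : R) k : 0 <= r -> exists C : R, 0 <= C /\
  forall a a' h : R[i], normc a <= r -> normc a' <= r -> a' - a = h * a * a' ->
    normc (a' ^+ k - a ^+ k - h * (k%:R * a ^+ k.+1)) <= C * normc h ^+ 2.
Proof.
move=> r0; elim: k => [|k [C [C0 IH]]].
  exists 0; split=> // a a' h _ _ _.
  by rewrite !expr0 mul0r mulr0 subr0 subrr mul0r /normc /= expr0n addr0 sqrtr0.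
exists (r * (C + k.+1%:R * r ^+ k.+2)); split.
  by rewrite mulr_ge0// addr_ge0// mulr_ge0// exprn_ge0.
move=> a a' h ar a'r E.
(* The remainder for [k + 1] is [a'] times the remainder for [k], up to a term of order [h ^ 2].
   This recursion produces the constant chosen above. *)
rewrite (_ : _ - _ - _ = a' * ((a' ^+ k - a ^+ k - h * (k%:R * a ^+ k.+1)) +
    h ^+ 2 * (k.+1%:R * a ^+ k.+2))); last first.
  have -> : a' ^+ k.+1 = a' * a' ^+ k by rewrite exprS.
  have -> : a ^+ k.+1 = a * a ^+ k by rewrite exprS.
  have -> : a ^+ k.+2 = a * (a * a ^+ k) by rewrite !exprS.
  rewrite [k.+1%:R]mulrS.
  suff : (a' - a - h * a * a') * (a ^+ k + h * (1 + k%:R) * a * a ^+ k) = 0.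
    by move=> E0; apply/eqP; rewrite -subr_eq0 -E0; apply/eqP; ring.
  by rewrite E subrr mul0r.
rewrite normcM -mulrA ler_pM ?normc_ge0//.
apply: le_trans (le_normcD _ _) _; rewrite mulrDl lerD//; first exact: IH.
rewrite (normcM (h ^+ 2)) (normcM k.+1%:R) !normcX mulrC ler_wpM2r ?exprn_ge0 ?normc_ge0//.
have -> : normc (k.+1%:R : R[i]) = k.+1%:R.
  by rewrite -(rmorph_nat (real_complex R)) normc_real ger0_norm.
by rewrite ler_wpM2l// lerXn2r ?nnegrE ?normc_ge0.
Qed.

Lemma cder_cpow p k z : 0 < complex.Im z ->
  cder (cpow p k) z (k%:R * cpow p k.+1 z).
Proof.
move=> z0; set v := complex.Im z.
(* Within distance [v / 2] of [z] the imaginary part stays at least [v / 2], so both resolvents are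
   bounded by [(v / 2)^-1]. *)
have v20 : 0 < v / 2 by rewrite divr_gt0.
have r0 : 0 <= (v / 2)^-1 by rewrite invr_ge0 ltW.
have [C [C0 HC]] := resolvent_pow_taylor k r0.
apply: (@cder_quadratic _ _ _ _ C (v / 2)) => // z' hz'.
have Imz' : v / 2 <= complex.Im z'.
  have := le_lt_trans (normr_Im_le _) hz'.
  rewrite (raddfB (@complex.Im R : Rcomplex R -> R)) /= ltr_norml => /andP[+ _].
  by rewrite -/v => h; lra.
have Imz : v / 2 <= complex.Im z by rewrite -/v; lra.
have z'0 := lt_le_trans v20 Imz'.
rewrite /cpow.
have m' := cmeas_resolvent z' k; have b' := cbounded_resolvent k z'0.
have m := cmeas_resolvent z k; have b := cbounded_resolvent k z0.
have m1 := cmeas_resolvent z k.+1; have b1 := cbounded_resolvent k.+1 z0.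
have mB := cmeasB m' m.
have bB := cboundedB b' b.
have mZ := cmeasM (cmeas_cst _ ((z' - z) * k%:R)) m1.
have bZ := cboundedZ ((z' - z) * k%:R) b1.
rewrite mulrA -(cintB _ m' b' m b) -(cintZ _ ((z' - z) * k%:R) m1 b1) -(cintB _ mB bB mZ bZ).
apply: cbounded_cint; first exact: cmeasB.
move=> w; rewrite -mulrA; apply: HC.
- exact: normc_resolvent_le.
- exact: normc_resolvent_le.
- by field; rewrite !subz_neq0.
Qed.

Lemma near_Im_gt0 z : 0 < complex.Im z ->
  \forall w \near (z : R[i]^o), 0 < complex.Im (w : R[i]).
Proof.
move=> z0; apply/nbhs_ballP; exists (complex.Im z)%:C => /=; first by rewrite ltcR.
move=> w; rewrite /ball /= ltc_normcP => /(le_lt_trans (normr_Im_le _)).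
rewrite (raddfB (@complex.Im R : Rcomplex R -> R)) /= ltr_norml => /andP[_ +].
by move=> h; lra.
Qed.

Lemma cderive_stieltjes p k z : 0 < complex.Im z ->
  cderive k (stieltjes p) z = k`!%:R * cpow p k.+1 z.
Proof.
elim: k z => [|k IH] z z0.
  by rewrite fact0 mul1r; apply: eq_cint => w; rewrite expr1.
rewrite /cderive derive1nS derive1E.
have H : is_derive (z : R[i]^o) (1 : R[i]^o) ((fun w => k`!%:R * cpow p k.+1 w) : R[i]^o -> R[i]^o)
    (k`!%:R * (k.+1%:R * cpow p k.+2 z)).
  apply: cder_eq (cderM (cder_cst _ _) (cder_cpow p k.+1 z0)) _.
  by rewrite mulr0 addr0.
rewrite factS mulnC natrM -mulrA.
have [_ <-] := H.
(* The induction hypothesis holds on the upper half-plane only, which is a neighbourhood of [z]. *)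
apply: (@near_eq_derive R[i] R[i]^o R[i]^o).
by apply: filterS (near_Im_gt0 z0) => w w0; exact: IH.
Qed.

End CauchyPowers.

(** * Linear equations on the upper half-plane *)

Section UpperHalfPlane.
Variable R : realType.
Implicit Types (p : probability (measurableTypeR R) R) (z : R[i]).

Lemma is_derive0_cst (f : R -> R) (a b : R) : a <= b ->
  (forall t, a <= t <= b -> is_derive t 1 f 0) -> f a = f b.
Proof.
move=> ab H.
have cf : {within `[a, b], continuous f}.
  apply: derivable_within_continuous => t /[!in_itv] /= tab.
  by have [] := H t tab.
have [c _ E] := @MVT_segment R f (fun=> 0) a b ab
  (fun t tab => H t (subset_itv_oo_cc tab)) cf.
by apply/eqP; rewrite eq_sym -subr_eq0 E mul0r.
Qed.

(** The half-plane is convex: restrict to the segment from [z] to [z'] and apply the mean value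
    theorem to the real and imaginary parts. *)
Lemma upper_cst (f : R[i] -> R[i]) :
  (forall z, 0 < complex.Im z -> cder f z 0) ->
  forall z z', 0 < complex.Im z -> 0 < complex.Im z' -> f z = f z'.
Proof.
move=> H z z' z0 z'0.
have P (t : R) : 0 <= t <= 1 -> 0 < complex.Im (z + t%:C * (z' - z)).
  case: z z' z0 z'0 {H} => [a b] [a' b'] /= b0 b'0 /andP[t0 t1].
  rewrite mul0r addr0.
  have -> : b + t * (b' - b) = t * b' + (1 - t) * b by ring.
  have [->|tn0] := eqVneq t 0; first by rewrite mul0r add0r subr0 mul1r.
  rewrite ltr_pwDl// ?mulr_gt0// ?lt_neqAle 1?eq_sym ?tn0//.
  by rewrite mulr_ge0 ?subr_ge0// ltW.
have L (t : R) : 0 <= t <= 1 ->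
    is_derive t 1 (fun s : R => complex.Re (f (z + s%:C * (z' - z)))) 0 /\
    is_derive t 1 (fun s : R => complex.Im (f (z + s%:C * (z' - z)))) 0.
  by move=> t01; have := cder_line (H _ (P t t01)); rewrite mulr0.
have := is_derive0_cst (@ler01 R) (fun t t01 => (L t t01).1).
have := is_derive0_cst (@ler01 R) (fun t t01 => (L t t01).2).
rewrite !rmorph0 !rmorph1 !mul0r !addr0 !mul1r !subrKC.
by move: (f z) (f z') => [? ?] [? ?] /= -> ->.
Qed.

(** The device by which an identity valid on the half-plane gets differentiated. *)
Lemma cder_unique (f g : R[i] -> R[i]) z d d' : 0 < complex.Im z ->
  (forall w, 0 < complex.Im w -> f w = g w) -> cder f z d -> cder g z d' -> d = d'.
Proof.
move=> z0 fg [_ <-] [_ <-].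
apply: (@near_eq_derive R[i] R[i]^o R[i]^o).
by apply: filterS (near_Im_gt0 z0) => w w0; exact: fg.
Qed.

(* Gronwall: [|u (x + i y)|^2 y^(-2N)] is nonincreasing in [y]. *)
Lemma upper_gronwall (N : nat) (S u : R[i] -> R[i]) (x y y' : R) :
  (forall z, 0 < complex.Im z -> normc (S z) <= (complex.Im z)^-1) ->
  (forall z, 0 < complex.Im z -> cder u z (N%:R * S z * u z)) ->
  0 < y -> y <= y' -> u (x +i* y) = 0 -> u (x +i* y') = 0.
Proof.
move=> HS Hu y0 yy' u0.
have E (s : R) : x%:C + s%:C * 'i = x +i* s.
  by simpc.
pose A (s : R) := complex.Re (u (x%:C + s%:C * 'i)) ^+ 2 +
                  complex.Im (u (x%:C + s%:C * 'i)) ^+ 2.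
pose M := (2 * N)%N.
pose G (s : R) := A s * s^-1 ^+ M.
(* Along the vertical line [u] has derivative [i u'], so [A = |u|^2] satisfies [A' = M q A], and
   [q <= |S| <= 1 / s]. The exponent [M = 2 N] is the one that makes [A s^-M] nonincreasing. *)
pose q (s : R) := complex.Re ('i * S (x +i* s)).
have A_ge0 s : 0 <= A s by rewrite addr_ge0// sqr_ge0.
have dA (s : R) : 0 < s -> is_derive s 1 A (M%:R * q s * A s).
  move=> s0; have z0 : 0 < complex.Im (x%:C + s%:C * 'i) by rewrite E.
  have [dr di] := cder_line (Hu _ z0).
  have := is_deriveD (is_deriveM dr dr) (is_deriveM di di).
  move=> /is_derive_eq; apply.
  rewrite /A /q /M -E /GRing.scale /= natrM.
  move: (u _) (S _) => [ur ui] [sr si].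
  have NE : N%:R = (N%:R : R)%:C by rewrite rmorph_nat.
  by rewrite NE /=; ring.
have dB (s : R) : 0 < s -> is_derive s 1 (fun t : R => t^-1 ^+ M) (- (M%:R * s^-1 ^+ M.+1)).
  move=> s0.
  have dV : is_derive s 1 (fun t : R => t^-1) (- s ^- 2 *: 1).
    by apply: (@is_deriveV _ id); rewrite gt_eqF.
  have := is_deriveX M dV; rewrite exprfctE => /is_derive_eq; apply.
  rewrite /GRing.scale /= mulr1; case: (M) => [|M']; first by rewrite !mul0r oppr0.
  by rewrite -(exprVn s 2) /= !exprS; ring.
have dG (s : R) : 0 < s ->
    is_derive s 1 G (A s * (- (M%:R * s^-1 ^+ M.+1)) + s^-1 ^+ M * (M%:R * q s * A s)).
  by move=> s0; exact: (is_deriveM (dA s s0) (dB s s0)).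
have G0 : G y = 0 by rewrite /G /A E u0 /= expr0n /= addr0 mul0r.
have Gy' : G y' <= G y.
  have pos s : y <= s -> 0 < s by exact: lt_le_trans.
  apply: (@ler0_derive1_le_cc R G y y') => //.
  - by move=> s /[!in_itv] /= /andP[/ltW ys _]; have [] := dG s (pos s ys).
  - move=> s /[!in_itv] /= /andP[/ltW ys _]; have s0 := pos s ys.
    rewrite derive1E; have [_ ->] := dG s s0.
    rewrite (_ : _ + _ = (M%:R * A s * s^-1 ^+ M) * (q s - s^-1)); last first.
      by rewrite exprS; ring.
    rewrite mulr_ge0_le0//.
      by rewrite !mulr_ge0// exprn_ge0// invr_ge0 ltW.
    rewrite subr_le0; apply: le_trans (ler_norm _) _; apply: le_trans (normr_Re_le _) _.
    by rewrite normcM /= !expr0n /= add0r expr1n sqrtr1 mul1r; exact: HS.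
  - apply: derivable_within_continuous => s /[!in_itv] /= /andP[ys _].
    by have [] := dG s (pos s ys).
  - by rewrite in_itv /= yy' lexx.
  - by rewrite in_itv /= lexx yy'.
have Ay' : A y' = 0.
  have y'0 : 0 < y' := lt_le_trans y0 yy'.
  apply/eqP; rewrite eq_le A_ge0 andbT.
  by rewrite -(pmulr_lle0 _ (exprn_gt0 M (_ : 0 < y'^-1))) ?invr_gt0// -/(G y') -G0.
move/eqP : Ay'; rewrite /A paddr_eq0 ?sqr_ge0// !sqrf_eq0 E.
by case: (u _) => ? ? /= /andP[/eqP -> /eqP ->].
Qed.

(** By [upper_gronwall] a zero at [x + i y] persists at every greater height, so the rescaled values
    would tend to [0] rather than to [i ^ N]. *)
Lemma upper_neq0 (N : nat) (S u : R[i] -> R[i]) :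
  (forall z, 0 < complex.Im z -> normc (S z) <= (complex.Im z)^-1) ->
  (forall z, 0 < complex.Im z -> cder u z (N%:R * S z * u z)) ->
  (forall x : R, ((j.+1%:R : R)%:C ^+ N * u (x +i* j.+1%:R) : R[i]^o)
     @[j --> \oo] --> ('i ^+ N : R[i]^o)) ->
  forall z, 0 < complex.Im z -> u z != 0.
Proof.
move=> HS Hu Hl [x y] /= y0; apply/eqP => u0.
have H0 : ((j.+1%:R : R)%:C ^+ N * u (x +i* j.+1%:R) : R[i]^o)
     @[j --> \oo] --> (0 : R[i]^o).
  apply: cvg_near_cst; near=> j.
  rewrite (upper_gronwall HS Hu y0 _ u0) ?mulr0//.
  rewrite (@le_trans _ _ j%:R)// ?ler_nat//; near: j; exact: nbhs_infty_ger.
have iN0 : 'i ^+ N = 0 :> R[i].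
  exact: (ccvg_unique (Hl x) H0).
have : 'i != 0 :> R[i] by rewrite eq_complex /= oner_eq0 andbF.
by move/eqP: iN0; rewrite expf_eq0 => /andP[_ ->].
Unshelve. all: by end_near. Qed.

(** Pointwise [y / (w - x - i y)] tends to [1 / (- i) = i] as [y] grows, and its modulus is at most
    [1]; bounded convergence concludes. Heights [j + 1] avoid the real axis. *)
Lemma cvg_cpow p k (x : R) :
  ((j.+1%:R : R)%:C ^+ k * cpow p k (x +i* j.+1%:R) : R[i]^o)
     @[j --> \oo] --> ('i ^+ k : R[i]^o).
Proof.
have Iz j : 0 < complex.Im (x +i* (j.+1%:R : R)) by rewrite /= ltr0n.
have E j : (j.+1%:R : R)%:C ^+ k * cpow p k (x +i* j.+1%:R) =
    cint p (fun w : R => (j.+1%:R : R)%:C ^+ k * (w%:C - (x +i* j.+1%:R))^-1 ^+ k).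
  by rewrite (cintZ p _ (cmeas_resolvent _ k) (cbounded_resolvent k (Iz j))).
rewrite (funext E) -(cint_cst p ('i ^+ k)).
apply: (@cint_dominated_cvg _ _ _ p _ _ 1).
- by move=> j; apply: cmeasM; [exact: cmeas_cst|exact: cmeas_resolvent].
- exact: cmeas_cst.
- move=> j w; rewrite normcM normcX normc_real.
  have := cbounded_resolvent k (Iz j) w; rewrite /= ger0_norm// => H.
  rewrite (@le_trans _ _ (j.+1%:R ^+ k * j.+1%:R^-1 ^+ k))//.
    by rewrite ler_wpM2l// exprn_ge0.
  by rewrite -exprMn divff ?expr1n// pnatr_eq0.
- apply: aeW => w.
  have L : (((w - x) * j.+1%:R^-1)%:C - 'i : R[i]^o) @[j --> \oo] --> (- 'i : R[i]^o).
    apply/cvg_complexP; split.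
      rewrite (_ : (fun _ => _) = fun j : nat => (w - x) * j.+1%:R^-1); last first.
        by apply/funext => j /=; rewrite subr0.
      rewrite [X in _ --> X](_ : _ = (w - x) * 0); last by rewrite /= oppr0 mulr0.
      by apply: cvgM; [exact: cvg_cst|exact: cvg_harmonic].
    rewrite (_ : (fun _ => _) = fun=> - 1); first exact: cvg_cst.
    by apply/funext => j /=; rewrite sub0r.
  have n0 : - 'i != 0 :> R[i]^o.
    by rewrite oppr_eq0 eq_complex /= oner_eq0 andbF.
  have -> : 'i ^+ k = (- 'i)^-1 ^+ k :> R[i].
    by congr (_ ^+ k); apply: (mulfI n0); rewrite divff// mulNr -expr2 sqr_i opprK.
  rewrite (_ : (fun _ => _) = (fun j : nat => (((w - x) * j.+1%:R^-1)%:C - 'i)^-1 ^+ k)).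
    by apply: ccvgX; apply: ccvgV.
  apply/funext => j.
  rewrite -exprMn; congr (_ ^+ k).
  have j0 : (j.+1%:R : R)%:C != 0 by rewrite fmorph_eq0 pnatr_eq0.
  rewrite (_ : _%:C - 'i = (w%:C - (x +i* j.+1%:R)) / j.+1%:R%:C).
    by rewrite invfM invrK mulrC.
  rewrite (_ : x +i* j.+1%:R = x%:C + j.+1%:R%:C * 'i); last by simpc.
  by rewrite rmorphM fmorphV rmorphB /=; field.
Qed.

End UpperHalfPlane.

(** * Consequences of the relations [phi_(n+1) = phi_n S] *)

Section StieltjesODE.
Variable R : realType.
Variables (alpha nu : probability (measurableTypeR R) R).
Implicit Types z w : R[i].
Let S := cpow alpha 1.

Let S_le z : 0 < complex.Im z -> normc (S z) <= (complex.Im z)^-1.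
Proof. by move=> z0; have := normc_cpow_le alpha 1 z0; rewrite expr1. Qed.

Lemma cder_cpow_step n z :
  (forall w, 0 < complex.Im w -> cpow nu n.+1 w = cpow nu n w * S w) ->
  0 < complex.Im z -> cder (cpow nu n) z (n%:R * S z * cpow nu n z).
Proof.
by move=> H z0; apply: cder_eq (cder_cpow nu n z0) _; rewrite H//; ring.
Qed.

Lemma cpow_neq0 n z :
  (forall w, 0 < complex.Im w -> cpow nu n.+1 w = cpow nu n w * S w) ->
  0 < complex.Im z -> cpow nu n z != 0.
Proof.
move=> H; apply: (upper_neq0 S_le); last exact: cvg_cpow.
by move=> w w0; exact: cder_cpow_step.
Qed.

Lemma cpow_power_relation n m z :
  (forall w, 0 < complex.Im w -> cpow nu n.+1 w = cpow nu n w * S w) ->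
  (forall w, 0 < complex.Im w -> cpow nu m.+1 w = cpow nu m w * S w) ->
  0 < complex.Im z -> cpow nu n z ^+ m = cpow nu m z ^+ n.
Proof.
move=> Hn Hm z0.
pose f (w : R[i]) := cpow nu n w ^+ m * (cpow nu m w ^+ n)^-1.
have m0 w : 0 < complex.Im w -> cpow nu m w ^+ n != 0.
  by move=> w0; rewrite expf_neq0// cpow_neq0.
have df w : 0 < complex.Im w -> cder f w 0.
  move=> w0.
  have dn := cderX_log m (cder_cpow_step Hn w0).
  have dm := cderX_log n (cder_cpow_step Hm w0).
  have dV := @cderV _ (fun w => cpow nu m w ^+ n) _ _ (m0 _ w0) dm.
  apply: cder_eq (cderM dn dV) _.
  by move: (m0 _ w0); move: (cpow nu n w ^+ m) (cpow nu m w ^+ n) => A B B0; field.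
pose c := f z.
have fc w : 0 < complex.Im w -> cpow nu n w ^+ m = c * cpow nu m w ^+ n.
  by move=> w0; rewrite /c (upper_cst df z0 w0) /f divfK// m0.
suff c1 : c = 1 by rewrite fc// c1 mul1r.
(* Multiplied by [(j + 1) ^ (n m)], both powers tend to [i ^ (n m)], which is nonzero; this forces
   [c = 1]. *)
have A : (((j.+1%:R : R)%:C ^+ n * cpow nu n (0 +i* j.+1%:R)) ^+ m : R[i]^o)
    @[j --> \oo] --> (('i ^+ n) ^+ m : R[i]^o).
  by apply: ccvgX; exact: cvg_cpow.
have B : (c * ((j.+1%:R : R)%:C ^+ m * cpow nu m (0 +i* j.+1%:R)) ^+ n : R[i]^o)
    @[j --> \oo] --> (c * ('i ^+ m) ^+ n : R[i]^o).
  apply: ccvgM; first exact: cvg_cst.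
  by apply: ccvgX; exact: cvg_cpow.
have i0 : ('i ^+ m) ^+ n != 0 :> R[i].
  by rewrite !expf_neq0// eq_complex /= oner_eq0 andbF.
apply: (mulIf i0); rewrite mul1r; apply: ccvg_unique B _.
rewrite -!exprM mulnC exprM.
apply: cvg_trans A; apply: near_eq_cvg; near=> j.
rewrite exprMn fc /= ?ltr0n// exprMn -!exprM mulnC; ring.
Unshelve. all: by end_near. Qed.

(** The equation [S' = S ^ 2] is the linear equation [u' = S u] solved by [u = S] itself. *)
Lemma stieltjes_sqr_neq0 z :
  (forall w, 0 < complex.Im w -> cpow alpha 2 w = S w ^+ 2) ->
  0 < complex.Im z -> S z != 0.
Proof.
move=> H; apply: (@upper_neq0 _ 1 S S S_le); last exact: cvg_cpow.
move=> w w0; apply: cder_eq (cder_cpow alpha 1 w0) _.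
by rewrite H// !mul1r expr2.
Qed.

Lemma stieltjes_of_sqr :
  (forall z, 0 < complex.Im z -> cpow alpha 2 z = S z ^+ 2) ->
  exists c : R[i], complex.Im c <= 0 /\
    forall z, 0 < complex.Im z -> S z = (c - z)^-1.
Proof.
move=> H; have S0 z := stieltjes_sqr_neq0 (z := z) H.
(* [(1 / S)' = - S' / S ^ 2 = - 1], so [f] is constant, and its value is [c]. *)
pose f z := (S z)^-1 + z.
have df z : 0 < complex.Im z -> cder f z 0.
  move=> z0; apply: cder_eq (cderD (cderV (S0 _ z0) (cder_cpow alpha 1 z0)) (cder_id z)) _.
  by rewrite H// mul1r mulNr mulVf ?expf_neq0 ?S0// addNr.
have i0 : 0 < complex.Im ('i : R[i]) by rewrite /= ltr01.
exists (f 'i).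
have E z : 0 < complex.Im z -> S z = (f 'i - z)^-1.
  by move=> z0; rewrite (upper_cst df i0 z0) /f addrK invrK.
(* If [c] were in the upper half-plane, the formula at [z = c] would read [S c = 0^-1 = 0], but [S]
   has no zero there. *)
split => //; rewrite leNgt; apply/negP => c0.
by have := S0 _ c0; rewrite E// subrr invr0 eqxx.
Qed.

(** From [phi_n ^ (n+1) = phi_(n+1) ^ n = phi_n ^ n S ^ n] follows [phi_n = S ^ n]. Differentiating
    gives [n S ^ (n+1) = n S ^ (n-1) S'], to be divided by [n S ^ (n-1)]. *)
Lemma stieltjes_sqr_succ n : (0 < n)%N ->
  (forall w, 0 < complex.Im w -> cpow nu n.+1 w = cpow nu n w * S w) ->
  (forall w, 0 < complex.Im w -> cpow nu n.+2 w = cpow nu n.+1 w * S w) ->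
  forall z, 0 < complex.Im z -> cpow alpha 2 z = S z ^+ 2.
Proof.
move=> n0 H H1.
have E z : 0 < complex.Im z -> cpow nu n z = S z ^+ n.
  move=> z0; have := cpow_power_relation H H1 z0.
  rewrite H// exprMn exprS mulrC => /mulfI; apply.
  by rewrite expf_neq0// cpow_neq0.
move=> z z0.
have S0 : S z != 0.
  by have := cpow_neq0 H z0; rewrite E// expf_eq0 n0.
have := cder_unique z0 E (cder_cpow nu n z0) (cderX n (cder_cpow alpha 1 z0)).
rewrite H// E// mul1r -mulrA => /mulfI.
rewrite pnatr_eq0 -lt0n n0 => /(_ isT).
case: n n0 {H H1 E} => // n _; rewrite exprSr -mulrA => /mulfI.
by rewrite expf_neq0// => /(_ isT).
Qed.

(* With [T = S'] and [D = T - S ^ 2] the two relations give [D' = -2 n S D], so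
   that [phi_n ^ 2 D] is constant, and it tends to [0] at infinity. *)
Lemma stieltjes_sqr_succ2 n :
  (forall w, 0 < complex.Im w -> cpow nu n.+1 w = cpow nu n w * S w) ->
  (forall w, 0 < complex.Im w -> cpow nu n.+3 w = cpow nu n.+2 w * S w) ->
  forall z, 0 < complex.Im z -> cpow alpha 2 z = S z ^+ 2.
Proof.
move=> H H2.
pose phi := cpow nu n; pose T := cpow alpha 2; pose U := cpow alpha 3.
have phi0 z : 0 < complex.Im z -> phi z != 0 by move=> z0; exact: cpow_neq0.
have dphi z : 0 < complex.Im z -> cder phi z (n%:R * S z * phi z) by exact: cder_cpow_step.
have dS z : 0 < complex.Im z -> cder S z (T z).
  by move=> z0; apply: cder_eq (cder_cpow alpha 1 z0) _; rewrite mul1r.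
have dT z : 0 < complex.Im z -> cder T z (2%:R * U z) by move=> z0; exact: cder_cpow.
have n1 : n.+1%:R != 0 :> R[i] by rewrite pnatr_eq0.
(* Derivative of [phi_(n+1) = phi_n S], where [S' = T]. *)
have E z : 0 < complex.Im z -> n.+1%:R * cpow nu n.+2 z =
    phi z * (n%:R * S z ^+ 2 + T z).
  move=> z0.
  rewrite (cder_unique z0 H (cder_cpow nu n.+1 z0) (cderM (dphi _ z0) (dS _ z0))).
  by ring.
(* Derivative of [E], using [phi_(n+2)' = (n+2) S phi_(n+2)] from the second relation; [phi_n] then
   factors out. Here [U] is half of [S'']. *)
have EU z : 0 < complex.Im z -> U z = n%:R * S z ^+ 3 + S z * T z - n%:R * S z * T z.
  move=> z0.
  have dL := cderM (cder_cst n.+1%:R z) (cder_cpow_step H2 z0).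
  have dQ := cderD (cderM (cder_cst n%:R z) (cderX 2 (dS _ z0))) (dT _ z0).
  have K := cder_unique z0 E dL (cderM (dphi _ z0) dQ).
  have Ez := E z z0.
  have p0 : 2%:R * phi z != 0 by rewrite mulf_neq0 ?phi0// pnatr_eq0.
  apply/eqP; rewrite -subr_eq0 -(mulrI_eq0 _ (mulfI p0)); apply/eqP.
  move/eqP: K; rewrite -subr_eq0 => /eqP K.
  move/eqP: Ez; rewrite -subr_eq0 => /eqP Ez.
  rewrite [LHS](_ : _ = n.+2%:R * S z * (n.+1%:R * cpow nu n.+2 z -
     phi z * (n%:R * S z ^+ 2 + T z)) - (n.+1%:R * (n.+2%:R * S z * cpow nu n.+2 z) +
     cpow nu n.+2 z * 0 - (phi z * (n%:R * (2%:R * S z ^+ 1 * T z) + S z ^+ 2 * 0 + 2%:R * U z) +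
     (n%:R * S z ^+ 2 + T z) * (n%:R * S z * phi z)))).
    by rewrite Ez [X in _ - X]K mulr0 subrr.
  by rewrite ![n.+2%:R]mulrS ![n.+1%:R]mulrS; ring.
pose D z := T z - S z ^+ 2.
pose F z := phi z ^+ 2 * D z.
have dF z : 0 < complex.Im z -> cder F z 0.
  move=> z0.
  apply: cder_eq (cderM (cderX 2 (dphi _ z0)) (cderB (dT _ z0) (cderX 2 (dS _ z0)))) _.
  by rewrite EU//; ring.
(* [|phi_n| ^ 2 <= y^(-2n)] and [|D| <= 2 y^(-2)] with [y = Im z]; the total exponent is at least
   [2], so the bound tends to [0] for every [n]. *)
have DF z : 0 < complex.Im z -> normc (F z) <= 2 * (complex.Im z)^-1 ^+ (n.*2.+2).
  move=> z0; rewrite normcM normcX.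
  have i0 : 0 <= (complex.Im z)^-1 by rewrite invr_ge0 ltW.
  have -> : 2 * (complex.Im z)^-1 ^+ n.*2.+2 =
     ((complex.Im z)^-1 ^+ n) ^+ 2 * ((complex.Im z)^-1 ^+ 2 + (complex.Im z)^-1 ^+ 2).
    by rewrite -exprM muln2 !exprS expr0; ring.
  apply: ler_pM; rewrite ?exprn_ge0 ?normc_ge0//.
    by apply: lerXn2r; rewrite ?nnegrE ?exprn_ge0 ?normc_ge0//; exact: normc_cpow_le.
  apply: le_trans (le_normcD _ _) _; rewrite normcN; apply: lerD.
    exact: normc_cpow_le.
  by rewrite normcX; apply: lerXn2r; rewrite ?nnegrE ?normc_ge0//; exact: S_le.
have F0 z : 0 < complex.Im z -> F z = 0.
  move=> z0; apply: eq0_normc; apply/eqP; rewrite eq_le normc_ge0 andbT.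
  apply/ler_addgt0Pl => e e0; rewrite addr0.
  have e20 : 0 < e / 2 by rewrite divr_gt0.
  have [j] := ltr_add_invr e20; rewrite add0r => je.
  have zj : 0 < complex.Im (0 +i* (j.+1%:R : R)) by rewrite /= ltr0n.
  rewrite (upper_cst dF z0 zj); apply: le_trans (DF _ zj) _ => /=.
  rewrite mulrC -ler_pdivlMr//; apply: le_trans (ltW je).
  rewrite exprS ger_pMr ?invr_gt0 ?ltr0n// exprn_ile1 ?invr_ge0 ?ler0n//.
  by rewrite invf_le1 ?ltr0n// ler1n.
move=> z z0; have := F0 z z0; move/eqP.
rewrite mulf_eq0 expf_eq0 (negPf (phi0 _ z0)) andbF /= subr_eq0 => /eqP //.
Qed.

End StieltjesODE.

(** * The stick-breaking recursion *)

Lemma measure_pushforward d1 d2 (T1 : measurableType d1) (T2 : measurableType d2)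
    (R : realType) (m : {measure set T1 -> \bar R}) (f : T1 -> T2) :
  measurable_fun setT f ->
  exists m' : {measure set T2 -> \bar R}, forall A, m' A = m (f @^-1` A).
Proof. by move=> mf; exists (pushforward m f). Unshelve. exact: mf. Qed.

Lemma probability_pushforward d1 d2 (T1 : measurableType d1) (T2 : measurableType d2)
    (R : realType) (P : probability T1 R) (f : T1 -> T2) :
  measurable_fun setT f ->
  exists Q : probability T2 R, forall A, Q A = P (f @^-1` A).
Proof.
move=> mf; pose X : {mfun T1 >-> T2} := HB.pack f (isMeasurableFun.Build _ _ _ _ f mf).
by exists (distribution P X).
Qed.

Section RectangleUniqueness.
Context d1 d2 (T1 : measurableType d1) (T2 : measurableType d2) (R : realType).

Lemma measure_rect_unique (m m' : {measure set (T1 * T2) -> \bar R}) :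
  (m setT < +oo)%E ->
  (forall A B, measurable A -> measurable B -> m (A `*` B) = m' (A `*` B)) ->
  forall X, measurable X -> m X = m' X.
Proof.
move=> moo H X mX.
apply: (measure_unique [set A `*` B | A in measurable & B in measurable]
  (fun=> setT)) => //.
- by rewrite measurable_prod_measurableType.
- move=> _ _ [A mA [B mB <-]] [A' mA' [B' mB' <-]].
  rewrite -setXI; exists (A `&` A'); first exact: measurableI.
  by exists (B `&` B') => //; exact: measurableI.
- by move=> _; exists setT => //; exists setT => //; exact: setXTT.
- by rewrite bigcup_const//; exists 0%N.
- by move=> _ [A mA [B mB <-]]; exact: H.
Qed.

(** Restrict [m] to the strip [A * T2] and push it forward by the second projection. Fixing one
    factor in this way reduces triple rectangles to double ones. *)
Lemma measure_section (m : {measure set (T1 * T2) -> \bar R}) (A : set T1) :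
  measurable A -> exists m' : {measure set T2 -> \bar R},
    forall B, m' B = m (A `*` B).
Proof.
move=> mA.
have mAT : measurable (A `*` [set: T2]) by exact: measurableX.
have [m' H] := measure_pushforward (mrestr m mAT) (@measurable_snd _ _ T1 T2).
exists m' => B; rewrite H /= /mrestr; congr (m _).
by apply/seteqP; split => -[x y] /=; tauto.
Qed.

End RectangleUniqueness.

Lemma measure_rect3_unique d1 d2 d3 (T1 : measurableType d1) (T2 : measurableType d2)
  (T3 : measurableType d3) (R : realType)
  (m m' : {measure set (T1 * (T2 * T3)) -> \bar R}) :
  (m setT < +oo)%E ->
  (forall A B C, measurable A -> measurable B -> measurable C ->
    m (A `*` (B `*` C)) = m' (A `*` (B `*` C))) ->
  forall X, measurable X -> m X = m' X.
Proof.
move=> moo H; apply: measure_rect_unique => // A F mA mF.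
have [n nE] := measure_section m mA.
have [n' nE'] := measure_section m' mA.
rewrite -nE -nE'; apply: measure_rect_unique mF => [|B C mB mC].
  rewrite nE; apply: le_lt_trans moo; apply: le_measure; rewrite ?inE//.
  exact: measurableX.
by rewrite nE nE'; exact: H.
Qed.

(** Horner form of the truncated series. It peels off the first term instead of the last, which is
    the shape of the distributional recursion; the index [k] allows tails of the same sequences. *)
Fixpoint stick_sum (R : realType) (y b : nat -> R) (N k : nat) : R :=
  if N is N'.+1 then y k * b k + (1 - y k) * stick_sum y b N' k.+1 else 0.

Lemma series_stick (R : realType) (y b : nat -> R) N :
  series (fun k => stick y k * b k) N = stick_sum y b N 0.
Proof.
rewrite /series /= big_mkord.
(* Generalised to sums starting at index [k], since the recursion moves the start. *)
suff H k : \sum_(i < N) stick (fun j => y (j + k)%N) i * b (i + k)%N = stick_sum y b N k.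
  rewrite -H; apply: eq_bigr => i _; rewrite addn0; congr (_ * _).
  by rewrite /stick addn0; congr (_ * _); apply: eq_bigr => j _; rewrite addn0.
elim: N k => [|N IH] k; first by rewrite big_ord0.
rewrite big_ord_recl /= {1}/stick big_ord0 mulr1 add0n; congr (_ + _).
rewrite -IH big_distrr /=; apply: eq_bigr => i _.
rewrite /stick /bump /= add1n big_ord_recl /= add0n addSnnS.
rewrite (eq_bigr (fun j : 'I_i => 1 - y (j + k.+1)%N)); first by ring.
by move=> j _; rewrite /bump /= add1n addSnnS.
Qed.

(** * Densities and the beta average of a resolvent power *)

Section Densities.
Variable R : realType.
Local Notation TR := (measurableTypeR R).
Local Notation mu := (@lebesgue_measure R).
Implicit Types (p : probability TR R).

Lemma FTC_is_derive (F f : R -> R) (a b : R) : a < b ->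
  (forall x : R, is_derive x 1 F (f x)) -> continuous f ->
  (\int[mu]_(x in `[a, b]) (f x)%:E = (F b - F a)%:E)%E.
Proof.
move=> ab HF cf.
have dF x : derivable F x 1 by have [] := HF x.
have cF x : {for x, continuous F}.
  exact/differentiable_continuous/derivable1_diffP.
rewrite (@continuous_FTC2 _ f F a b ab) ?EFinB//.
- by apply: continuous_in_subspaceT => x _; exact: cf.
- split => [x _ //||].
  + exact/cvg_at_right_filter/cF.
  + exact/cvg_at_left_filter/cF.
- by move=> x _; rewrite derive1E; have [_ ->] := HF x.
Qed.

(** The density makes [p] absolutely continuous, and it agrees almost everywhere with the
    Radon-Nikodym derivative, for which the change of variables holds. *)
Lemma integral_density p (f g : R -> R) (M : R) :
  has_density p f -> (forall x, 0 <= f x) -> measurable_fun setT f ->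
  measurable_fun [set: TR] g -> (forall x, `|g x| <= M) ->
  (\int[p]_x (g x)%:E = \int[mu]_x (g x * f x)%:E)%E.
Proof.
move=> pf f0 mf mg bg.
have pmu : p `<< mu.
  apply/null_content_dominatesP => A mA A0.
  by rewrite pf//; apply: null_set_integral => //; apply/measurable_EFinP/measurable_funTS.
have intf : mu.-integrable setT (EFin \o f).
  apply/integrableP; split; first exact/measurable_EFinP.
  under eq_integral do rewrite /= ger0_norm//.
  by rewrite -pf// probability_setT ltry.
have intg : p.-integrable setT (EFin \o g) by exact: (@bounded_integrable _ _ _ p g M).
rewrite -(Radon_Nikodym_change_of_variables pmu measurableT intg).
apply: ae_eq_integral => //.
- apply: emeasurable_funM; first exact/measurable_EFinP.
  by apply: (measurable_int mu); apply: Radon_Nikodym_integrable; exact: pmu.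
- by apply/measurable_EFinP; exact: measurable_funM.
- under [X in ae_eq _ _ _ X]eq_fun do rewrite EFinM.
  apply: ae_eqe_mul2l.
  rewrite Radon_NikodymE; case: cid => /= h [h1 h2 h3].
  apply: integral_ae_eq => //; first exact/measurable_EFinP.
  by move=> E _ mE; rewrite -h3// -pf.
Qed.

Lemma cder_real (f : R[i] -> R[i]) (t : R) d : cder f t%:C d ->
  is_derive t 1 (fun s : R => complex.Re (f s%:C)) (complex.Re d) /\
  is_derive t 1 (fun s : R => complex.Im (f s%:C)) (complex.Im d).
Proof.
have E (s : R) : 0 + s%:C * 1 = s%:C by rewrite add0r mulr1.
move=> fd; have := @cder_line R f 0 1 t d; rewrite E mul1r => /(_ fd).
rewrite (_ : (fun s : R => complex.Re (f (0 + s%:C * 1))) = (fun s : R => complex.Re (f s%:C))).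
  rewrite (_ : (fun s : R => complex.Im (f (0 + s%:C * 1))) = (fun s : R => complex.Im (f s%:C)))//.
  by apply/funext => s; rewrite E.
by apply/funext => s; rewrite E.
Qed.

Lemma beta1_pdfE n (y : R) : beta1_pdf n.+1%:R y =
  (n.+1%:R * (1 - y) ^+ n) * \1_(`]0, 1[%classic) y.
Proof.
rewrite /beta1_pdf indicE mem_setE in_itv /=.
case: ifPn => [/andP[y0 y1]|_]; last by rewrite mulr0.
rewrite (_ : n.+1%:R - 1 = n%:R); last by rewrite -natr1 addrK.
by rewrite mulr1 powR_mulrn// subr_ge0 ltW.
Qed.

Lemma integral_beta1 p n (g : R -> R) (M : R) :
  has_density p (beta1_pdf n.+1%:R) -> measurable_fun [set: TR] g ->
  (forall x, `|g x| <= M) ->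
  (\int[p]_x (g x)%:E =
   \int[mu]_(x in `[0%R, 1%R]) (g x * (n.+1%:R * (1 - x) ^+ n))%:E)%E.
Proof.
move=> pn mg bg.
have mq : measurable_fun [set: R] (fun x : R => n.+1%:R * (1 - x) ^+ n).
  apply: measurable_funM; first exact: measurable_cst.
  by apply: measurable_funX; apply: measurable_funB; [exact: measurable_cst|exact: measurable_id].
rewrite (integral_density pn _ _ mg bg).
(* The density lives on the open interval, the fundamental theorem on the closed one; the endpoints
   are null. *)
- rewrite -integral_itv_obnd_cbnd; last first.
    by apply: measurable_funTS; apply/measurable_EFinP; exact: measurable_funM.
  rewrite -integral_itv_bndo_bndc; last first.
    by apply: measurable_funTS; apply/measurable_EFinP; exact: measurable_funM.
  rewrite [RHS]integral_mkcond; apply: eq_integral => x _ /=.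
  rewrite beta1_pdfE patchE indicE; case: ifPn => _; rewrite ?mulr1//.
  by rewrite !mulr0.
- move=> x; rewrite beta1_pdfE indicE mem_setE in_itv /=.
  case: (boolP (0 < x < 1)) => [/andP[x0 x1]|_]; last by rewrite mulr0.
  by rewrite mulr1 mulr_ge0// exprn_ge0// subr_ge0 ltW.
- rewrite (funext (beta1_pdfE n)).
  by apply: measurable_funM => //; exact: measurable_indic.
Qed.

(* [- q^-1 ((1 - y) / ((1 - y) p + y q))^(n+1)] is a primitive of
   [(n+1) (1 - y)^n / ((1 - y) p + y q)^(n+2)]. *)
Lemma cint_beta1 p n (b x : R) (z : R[i]) : 0 < complex.Im z ->
  has_density p (beta1_pdf n.+1%:R) ->
  cint p (fun y : TR => ((y * b + (1 - y) * x : R)%:C - z)^-1 ^+ n.+2) =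
  (x%:C - z)^-1 ^+ n.+1 * (b%:C - z)^-1.
Proof.
move=> z0 pn.
(* The denominator [(1 - s) p + s q] with [p = x - z], [q = b - z]. For real [s] it is a real number
   minus [z], hence nonzero. *)
pose D (s : R[i]) := s * (b%:C - z) + (1 - s) * (x%:C - z).
have DE (y : R) : D y%:C = (y * b + (1 - y) * x : R)%:C - z.
  by rewrite /D rmorphD !rmorphM rmorphB rmorph1 /=; ring.
have D0 (y : R) : D y%:C != 0 by rewrite DE subz_neq0.
have q0 : b%:C - z != 0 by exact: subz_neq0.
pose Phi (s : R[i]) := - (b%:C - z)^-1 * ((1 - s) * (D s)^-1) ^+ n.+1.
pose Psi (s : R[i]) := (D s)^-1 ^+ n.+2 * (n.+1%:R * (1 - s) ^+ n).
have dD s : cder D s ((b%:C - z) - (x%:C - z)).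
  have dq := cderM (cder_id s) (cder_cst (b%:C - z) s).
  have d1 := cderB (cder_cst 1 s) (cder_id s).
  apply: cder_eq (cderD dq (cderM d1 (cder_cst (x%:C - z) s))) _.
  by rewrite !mulr0 !add0r; ring.
have dPhi (y : R) : cder Phi y%:C (Psi y%:C).
  have d1 := cderB (cder_cst 1 y%:C) (cder_id y%:C).
  have dV := cderV (D0 y) (dD y%:C).
  apply: cder_eq (cderM (cder_cst _ _) (cderX n.+1 (cderM d1 dV))) _.
  rewrite /Psi /= mulr0 addr0 exprMn.
  have -> : (D y%:C)^-1 ^+ n.+2 = (D y%:C)^-1 ^+ n * (D y%:C) ^- 2.
    by rewrite -exprVn -exprD addn2.
  (* [(1 - y) D' + D = q] collapses the numerator of the derivative of [(1 - y) / D] to [- q], which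
     cancels the factor [- q^-1] in [Phi]. *)
  have E : (1 - y%:C) * (b%:C - z - (x%:C - z)) + D y%:C = b%:C - z by rewrite /D; ring.
  have -> : (1 - y%:C) * (- (D y%:C) ^- 2 * (b%:C - z - (x%:C - z))) + (D y%:C)^-1 * (0 - 1) =
      - (D y%:C) ^- 2 * (b%:C - z).
    by rewrite -[in RHS]E; field; exact: D0.
  by field; rewrite D0.
have cPsi : continuous (fun y : R => complex.Re (Psi y%:C)) /\
    continuous (fun y : R => complex.Im (Psi y%:C)).
  have H (y : R) : exists d, cder Psi y%:C d.
    have d1 := cderB (cder_cst 1 y%:C) (cder_id y%:C).
    have dV := cderX n.+2 (cderV (D0 y) (dD y%:C)).
    by eexists; exact: (cderM dV (cderM (cder_cst n.+1%:R _) (cderX n d1))).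
  split => y; have [d /cder_real[[dr _] [di _]]] := H y.
  - exact/differentiable_continuous/derivable1_diffP.
  - exact/differentiable_continuous/derivable1_diffP.
pose G (y : TR) := (D (y : R)%:C)^-1 ^+ n.+2.
have -> : cint p (fun y : TR => ((y * b + (1 - y) * x : R)%:C - z)^-1 ^+ n.+2) = cint p G.
  by apply: eq_cint => y; rewrite /G DE.
have mG : cmeas G.
  apply: cmeasX; apply: cmeasV; rewrite (funext DE); apply: cmeasB; last exact: cmeas_cst.
  apply: cmeas_real.
  have m1 : measurable_fun [set: TR] (fun y : TR => y : R) by exact: measurable_id.
  apply: measurable_funD; apply: measurable_funM => //; try exact: measurable_cst.
  by apply: measurable_funB => //; exact: measurable_cst.
have bG : cbounded ((complex.Im z)^-1 ^+ n.+2) G.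
  by move=> y; rewrite /G DE; exact: cbounded_resolvent.
have Phi1 : Phi 1%:C = 0 by rewrite /Phi subrr mul0r expr0n mulr0.
have Phi0 : Phi 0%:C = - ((x%:C - z)^-1 ^+ n.+1 * (b%:C - z)^-1).
  by rewrite /Phi /D subr0 mul0r add0r !mul1r mulNr mulrC.
have E (y : R) : ((n.+1%:R * (1 - y) ^+ n : R)%:C) = n.+1%:R * (1 - y%:C) ^+ n.
  by rewrite rmorphM rmorphXn rmorphB rmorph1 rmorph_nat.
rewrite -[RHS]opprK -Phi0 -[RHS]add0r -Phi1 /cint.
transitivity (Complex (complex.Re (Phi 1%:C) - complex.Re (Phi 0%:C))
  (complex.Im (Phi 1%:C) - complex.Im (Phi 0%:C))); last first.
  by case: (Phi _) (Phi _) => ? ? [? ?].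
congr Complex.
- rewrite /Rintegral (integral_beta1 pn mG.1 (fun y => le_trans (normr_Re_le _) (bG y))).
  have := FTC_is_derive ltr01 (fun y => (cder_real (dPhi y)).1) cPsi.1.
  under eq_integral do rewrite /Psi -E [_ * _%:C]mulrC ReM /= mul0r subr0 mulrC.
  by move=> ->.
- rewrite /Rintegral (integral_beta1 pn mG.2 (fun y => le_trans (normr_Im_le _) (bG y))).
  have := FTC_is_derive ltr01 (fun y => (cder_real (dPhi y)).2) cPsi.2.
  under eq_integral do rewrite /Psi -E [_ * _%:C]mulrC ImM /= mul0r addr0 mulrC.
  by move=> ->.
Qed.

End Densities.

(** * Independence of tails and the Markov-Krein relation *)

Section MarkovKrein.
Context d (Omega : measurableType d) (R : realType) (P : probability Omega R).
Local Notation TR := (measurableTypeR R).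
Variables (B Y : nat -> Omega -> TR).
Hypothesis mB : forall k, measurable_fun setT (B k).
Hypothesis mY : forall k, measurable_fun setT (Y k).

Let T N k (w : Omega) : TR := stick_sum (Y^~ w : nat -> R) (B^~ w : nat -> R) N k.
Let Z (i : nat + nat) : Omega -> TR := match i with inl k => B k | inr k => Y k end.
Let index (i : nat + nat) := match i with inl k => k | inr k => k end.
Let cyl (s : seq (nat + nat)) (A : nat + nat -> set TR) :=
  [set w | forall i, i \in s -> A i (Z i w)].

Hypothesis indep : mutually_independent P Z.
Variables pB pY : probability (measurableTypeR R) R.
Hypothesis lawB : forall k A, measurable A -> P (B k @^-1` A) = pB A.
Hypothesis lawY : forall k A, measurable A -> P (Y k @^-1` A) = pY A.

Let measurable_Z i : measurable_fun setT (Z i).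
Proof. by case: i. Qed.

Let measurable_T N k : measurable_fun setT (T N k).
Proof.
elim: N k => [|N IH] k; first exact: measurable_cst.
have mYR : measurable_fun setT (Y k : Omega -> R) by exact: mY.
have mBR : measurable_fun setT (B k : Omega -> R) by exact: mB.
have mTR : measurable_fun setT (T N k.+1 : Omega -> R) by exact: IH.
have m1Y := measurable_funB (measurable_cst (1 : R)) mYR.
exact: (measurable_funD (measurable_funM mYR mBR) (measurable_funM m1Y mTR)).
Qed.

Let measurable_preimage d' (T' : measurableType d') (f : Omega -> T') A :
  measurable_fun setT f -> measurable A -> measurable (f @^-1` A).
Proof. by move=> mf mA; rewrite -[X in measurable X]setTI; exact: mf. Qed.

Let cyl_cons i s A : cyl (i :: s) A = (Z i @^-1` A i) `&` cyl s A.
Proof.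
apply/seteqP; split => w /=.
  move=> H; split; first by apply: H; rewrite mem_head.
  by move=> j js; apply: H; rewrite inE js orbT.
by move=> [Hi Hs] j; rewrite inE => /orP[/eqP ->//|]; exact: Hs.
Qed.

Let measurable_cyl s A : (forall i, measurable (A i)) -> measurable (cyl s A).
Proof.
move=> mA; elim: s => [|i s IH].
  by rewrite (_ : cyl _ _ = setT)//; apply/seteqP; split.
by rewrite cyl_cons; apply: measurableI => //; exact: measurable_preimage.
Qed.

Let eq_cyl s A A' : (forall i, i \in s -> A i = A' i) -> cyl s A = cyl s A'.
Proof.
by move=> H; apply/seteqP; split => w h i /[dup] si /H; [move=> <-|move=> ->]; exact: h.
Qed.

Let stick_step (z : TR * (TR * TR)) : TR := (z.1 : R) * z.2.1 + (1 - z.1) * z.2.2.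

Let measurable_stick_step : measurable_fun setT stick_step.
Proof.
have m1 : measurable_fun setT (fun z : TR * (TR * TR) => z.1 : R).
  exact: measurable_fst.
have m2 : measurable_fun setT (fun z : TR * (TR * TR) => z.2.1 : R).
  exact: (measurableT_comp measurable_fst measurable_snd).
have m3 : measurable_fun setT (fun z : TR * (TR * TR) => z.2.2 : R).
  exact: (measurableT_comp measurable_snd measurable_snd).
have m4 := measurable_funB (measurable_cst (1 : R)) m1.
exact: (measurable_funD (measurable_funM m1 m2) (measurable_funM m4 m3)).
Qed.

Let W N k (w : Omega) : TR * (TR * TR) := (Y k w, (B k w, T N k.+1 w)).

Let measurable_W N k : measurable_fun setT (W N k).
Proof.
by apply: measurable_fun_pair => //; exact: measurable_fun_pair.
Qed.

(* One induction on [N] gives both the independence of the tail sums from the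
   earlier variables and the invariance of their law under the shift. *)
Definition tail_indep N := forall k s A, uniq s ->
  (forall i, i \in s -> (index i < k)%N) -> (forall i, measurable (A i)) ->
  forall E, measurable E ->
  P (cyl s A `&` T N k @^-1` E) = (P (cyl s A) * P (T N 0%N @^-1` E))%E.

Let W_rect N : tail_indep N -> forall k s A, uniq s ->
  (forall i, i \in s -> (index i < k)%N) -> (forall i, measurable (A i)) ->
  forall A1 A2 A3, measurable A1 -> measurable A2 -> measurable A3 ->
  P (cyl s A `&` W N k @^-1` (A1 `*` (A2 `*` A3))) =
  (P (cyl s A) * (pY A1 * (pB A2 * P (T N 0%N @^-1` A3))))%E.
Proof.
move=> tN k s A us sk mA A1 A2 A3 mA1 mA2 mA3.
(* The events on [Y k] and [B k] are absorbed into the cylinder. Both indices are fresh because [s]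
   only involves indices below [k], and [tail_indep] is then applied at [k + 1]. *)
pose s' := inr k :: inl k :: s.
pose A' i := if i == inr k then A1 else if i == inl k then A2 else A i.
have nl : (inl k : nat + nat) \notin s by apply/negP => /sk /=; rewrite ltnn.
have nr : (inr k : nat + nat) \notin s by apply/negP => /sk /=; rewrite ltnn.
have us' : uniq s' by rewrite /= inE /= nr nl us.
have A'r : A' (inr k) = A1 by rewrite /A' eqxx.
have A'l : A' (inl k) = A2 by rewrite /A' /= eqxx.
have mA' i : measurable (A' i) by rewrite /A'; case: ifP => // _; case: ifP.
have s'k i : i \in s' -> (index i < k.+1)%N.
  by rewrite !inE => /or3P[/eqP ->|/eqP ->|/sk /ltnW].
have cE : cyl s A' = cyl s A.
  apply: eq_cyl => i si; rewrite /A'; case: ifPn => [/eqP e|_].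
    by move: nr; rewrite -e si.
  by case: ifPn => [/eqP e|//]; move: nl; rewrite -e si.
have -> : cyl s A `&` W N k @^-1` (A1 `*` (A2 `*` A3)) = cyl s' A' `&` T N k.+1 @^-1` A3.
  rewrite /s' !cyl_cons cE A'r A'l.
  apply/seteqP; split => w.
    by move=> [c [y [b t]]].
  by move=> [[y [b c]] t].
rewrite tN// [in LHS]indep// [in RHS]indep// /s' !big_cons A'r A'l lawB// lawY//.
rewrite (_ : (\prod_(i <- s) P (Z i @^-1` A' i) = \prod_(i <- s) P (Z i @^-1` A i))%E); last first.
  apply: eq_big_seq => i si; rewrite /A'; case: ifPn => [/eqP e|_].
    by move: nr; rewrite -e si.
  by case: ifPn => [/eqP e|//]; move: nl; rewrite -e si.
by rewrite [RHS]muleC !muleA [RHS]muleAC.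
Qed.

Let cyl_nil A : cyl [::] A = setT.
Proof. by apply/seteqP; split. Qed.

Let W_rect0 N : tail_indep N ->
  forall A1 A2 A3, measurable A1 -> measurable A2 -> measurable A3 ->
  P (W N 0 @^-1` (A1 `*` (A2 `*` A3))) =
  (pY A1 * (pB A2 * P (T N 0%N @^-1` A3)))%E.
Proof.
move=> tN A1 A2 A3 mA1 mA2 mA3.
have := @W_rect N tN 0%N [::] (fun=> setT) isT (fun i => _) (fun=> measurableT) _ _ _ mA1 mA2 mA3.
by rewrite cyl_nil setTI probability_setT mul1e; apply.
Qed.

(** As functions of [F] both sides are finite measures, and they agree on triple rectangles by
    [W_rect]. *)
Let W_indep N : tail_indep N -> forall k s A, uniq s ->
  (forall i, i \in s -> (index i < k)%N) -> (forall i, measurable (A i)) ->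
  forall F, measurable F ->
  P (cyl s A `&` W N k @^-1` F) = (P (cyl s A) * P (W N 0 @^-1` F))%E.
Proof.
move=> tN k s A us sk mA F mF.
have mC := measurable_cyl s mA.
have [m mE] := measure_pushforward (mrestr P mC) (measurable_W N k).
have [m0 m0E] := measure_pushforward P (measurable_W N 0).
have c0 : 0 <= fine (P (cyl s A)) by exact: fine_ge0.
have cE : P (cyl s A) = (fine (P (cyl s A)))%:E by rewrite fineK// fin_num_measure.
pose m' := mscale (NngNum c0) m0.
have mE' G : m G = P (cyl s A `&` W N k @^-1` G) by rewrite mE /= /mrestr setIC.
have mE0 G : m' G = (P (cyl s A) * P (W N 0 @^-1` G))%E by rewrite /m' /mscale /= m0E cE.
rewrite -mE' -mE0; apply: measure_rect3_unique mF => [|A1 A2 A3 mA1 mA2 mA3].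
  rewrite mE'; apply: le_lt_trans (ltry 1).
  by apply: probability_le1; apply: measurableI => //; rewrite preimage_setT.
rewrite mE'; etransitivity; first exact: (W_rect tN us sk mA mA1 mA2 mA3).
by etransitivity; last exact/esym/mE0; congr (_ * _)%E; exact/esym/W_rect0.
Qed.

(** [T N.+1 k] is by computation [stick_step] applied to [W N k], so [W_indep] passes to it; [T 0 k]
    is the constant [0]. *)
Lemma tail_indepP N : tail_indep N.
Proof.
elim: N => [|N IH] k s A us sk mA E mE.
  have [E0|E0] := pselect (E 0).
    have -> j : T 0 j @^-1` E = setT by apply/seteqP; split.
    by rewrite setIT probability_setT mule1.
  have -> j : T 0 j @^-1` E = set0 by apply/seteqP; split.
  by rewrite setI0 measure0 mule0.
have mF : measurable (stick_step @^-1` E).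
  by rewrite -[X in measurable X]setTI; exact: measurable_stick_step.
exact: (W_indep IH us sk mA mF).
Qed.

(** The triple [(Y 0, B 0, T N 1)] has the product law of [pY], [pB] and [tau]; two uses of Fubini
    follow. *)
Lemma cint_stick_step N (tau : probability (measurableTypeR R) R) (f : TR -> R[i]) M :
  (forall A, measurable A -> tau A = P (T N 0 @^-1` A)) ->
  cmeas f -> cbounded M f ->
  cint P (fun w => f (T N.+1 0 w)) =
  cint tau (fun x => cint pB (fun b => cint pY (fun y => f (y * b + (1 - y) * x : R)))).
Proof.
move=> tauE mf bf.
have mg : cmeas (fun z : TR * (TR * TR) =>
    f (stick_step z)).
  exact: (cmeas_comp measurable_stick_step mf).
have bg : cbounded M (fun z : TR * (TR * TR) =>
    f (stick_step z)) by move=> z; exact: bf.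
pose Q : probability (TR * (TR * TR))%type R := (pY \x (pB \x tau))%E.
have QE F : measurable F -> Q F = P (W N 0 @^-1` F).
  move=> mF; have [m0 m0E] := measure_pushforward P (measurable_W N 0).
  rewrite -m0E.
  apply: (@measure_rect3_unique _ _ _ TR TR TR R Q m0) => // [|A1 A2 A3 mA1 mA2 mA3].
    apply: le_lt_trans (ltry 1); exact: probability_le1.
  rewrite m0E [RHS](W_rect0 (tail_indepP N))// -tauE//.
  rewrite /Q [LHS]product_measure1E//; last exact: measurableX.
  by congr (_ * _)%E; exact: product_measure1E.
rewrite -[LHS](@cint_pushforward _ _ _ _ _ P Q (W N 0) _ M (measurable_W N 0) mg bg QE).
rewrite (cint_fubini pY _ mg bg).
have mh : cmeas (fun v : TR * TR =>
    cint pY (fun y => f (stick_step (y, v)))).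
  exact: (cmeas_cint pY (pB \x tau)%E mg bg).
have bh : cbounded M (fun v : TR * TR =>
    cint pY (fun y => f (stick_step (y, v)))).
  move=> v; apply: cbounded_cint; last by move=> y; exact: bf.
  by apply: (cmeas_comp (u := fun y => (y, v)) _ mg); exact: measurable_pair2.
by rewrite (cint_fubini pB tau mh bh).
Qed.

Variable n : nat.
Hypothesis pY_beta : has_density pY (beta1_pdf n.+1%:R).

Let cmeas_T N k z : cmeas (fun w => ((T N 0 w : R)%:C - z)^-1 ^+ k).
Proof. exact: (cmeas_comp (measurable_T N 0) (cmeas_resolvent z k)). Qed.

(** The inner beta integral of the power [n + 2] splits into a factor in [x] and a factor in [b], so
    the remaining double integral is a product. The beta parameter is [t = n + 1]. *)
Lemma cint_stick_resolvent N z : 0 < complex.Im z ->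
  cint P (fun w => ((T N.+1 0 w : R)%:C - z)^-1 ^+ n.+2) =
  cint P (fun w => ((T N 0 w : R)%:C - z)^-1 ^+ n.+1) * cpow pB 1 z.
Proof.
move=> z0; have [tau tauE] := probability_pushforward P (measurable_T N 0).
have br := cbounded_resolvent n.+2 z0.
have br1 := cbounded_resolvent n.+1 z0.
have bb := cbounded_resolvent 1 z0.
rewrite (cint_stick_step (fun A _ => tauE A) (cmeas_resolvent z n.+2) br).
rewrite -(cint_pushforward (measurable_T N 0) (cmeas_resolvent z n.+1) br1 (fun A _ => tauE A)).
rewrite mulrC -(cintZ tau _ (cmeas_resolvent z n.+1) br1).
apply: eq_cint => x.
rewrite mulrC /cpow -(cintZ pB _ (cmeas_resolvent z 1) bb).
by apply: eq_cint => b; rewrite expr1; exact: cint_beta1.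
Qed.

(** Bounded convergence as [N] grows, on both sides of [cint_stick_resolvent]; almost sure
    convergence of the series makes the integrands converge. *)
Lemma markov_krein (nu : probability TR R) (X : Omega -> TR) z :
  measurable_fun setT X ->
  {ae P, forall w, series (fun k => stick (Y^~ w : nat -> R) k * B k w : R) @ \oo --> (X w : R)} ->
  (forall A, measurable A -> nu A = P (X @^-1` A)) -> 0 < complex.Im z ->
  cpow nu n.+2 z = cpow nu n.+1 z * cpow pB 1 z.
Proof.
move=> mX cvX nuE z0.
have cvg k : (cint P (fun w => ((T N 0 w : R)%:C - z)^-1 ^+ k) : R[i]^o) @[N --> \oo] -->
    (cpow nu k z : R[i]^o).
  have br := cbounded_resolvent k z0.
  rewrite /cpow (cint_pushforward mX (cmeas_resolvent z k) br nuE).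
  apply: (@cint_dominated_cvg _ _ _ P _ _ ((complex.Im z)^-1 ^+ k)) => //.
  - exact: (cmeas_comp mX (cmeas_resolvent z k)).
  - by move=> N w; exact: br.
  - apply: filterS cvX => w Xw.
    apply: ccvgX; apply: ccvgV; first exact: subz_neq0.
    have TX : (T N 0 w : R) @[N --> \oo] --> (X w : R).
      by rewrite /T; under eq_fun do rewrite -series_stick.
    apply/cvg_complexP; case: (z) => a b /=; split.
      by apply: cvgB => //; exact: cvg_cst.
    exact: cvg_cst.
have c1 := cvg n.+2.
have c2 : (cint P (fun w => ((T N 0 w : R)%:C - z)^-1 ^+ n.+1) * cpow pB 1 z : R[i]^o)
    @[N --> \oo] --> (cpow nu n.+1 z * cpow pB 1 z : R[i]^o).
  by apply: ccvgM; [exact: cvg|exact: cvg_cst].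
apply: (ccvg_unique (F := \oo) (f := fun N =>
  cint P (fun w => ((T N.+1 0 w : R)%:C - z)^-1 ^+ n.+2))).
  exact: ccvg_shiftS c1.
by rewrite (funext (fun N => cint_stick_resolvent N z0)).
Qed.

End MarkovKrein.

(** * Inversion of the Stieltjes transform *)

Section CauchyDirac.
Variable R : realType.
Local Notation TR := (measurableTypeR R).
Local Notation mu := (@lebesgue_measure R).
Implicit Types (p : probability TR R).

(** The Poisson kernel of the half-plane, without its factor [1 / pi]. *)
Definition poisson_kernel (v t : R) : R := v / (t ^+ 2 + v ^+ 2).

Lemma poisson_kernel_ge0 v t : 0 <= v -> 0 <= poisson_kernel v t.
Proof. by move=> v0; rewrite divr_ge0// addr_ge0// sqr_ge0. Qed.

Lemma continuous_poisson_kernel v : 0 < v -> continuous (poisson_kernel v).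
Proof.
move=> v0 t; rewrite /poisson_kernel.
apply: cvgM; first exact: cvg_cst.
apply: cvgV; first by rewrite gt_eqF// ltr_wpDl ?sqr_ge0// exprn_gt0.
by apply: cvgD; [exact: exprn_continuous|exact: cvg_cst].
Qed.

Lemma measurable_poisson_kernel v : 0 < v -> measurable_fun setT (poisson_kernel v).
Proof. by move=> v0; apply: continuous_measurable_fun; exact: continuous_poisson_kernel. Qed.

Lemma is_derive_atan_poisson (v c u : R) : 0 < v ->
  is_derive u 1 (fun s : R => atan ((s - c) / v)) (poisson_kernel v (u - c)).
Proof.
move=> v0.
have d1 : is_derive u 1 (fun s : R => (s - c) / v) v^-1.
  have := is_deriveM (is_deriveB (is_derive_id u 1) (is_derive_cst c u 1)) (is_derive_cst v^-1 u 1).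
  by move=> /is_derive_eq; apply; rewrite /GRing.scale /= mulr0 add0r subr0 mulr1.
have := @is_derive1_comp R atan (fun s : R => (s - c) / v) u _ _ (is_derive1_atan _) d1.
move=> /is_derive_eq; apply; rewrite /GRing.scale /= /poisson_kernel; field.
have h : 0 < (u - c) ^+ 2 + v ^+ 2 by rewrite ltr_wpDl ?sqr_ge0// exprn_gt0.
by rewrite !gt_eqF//= addrC.
Qed.

Lemma integral_poisson_kernel (v c s t : R) : 0 < v -> s < t ->
  (\int[mu]_(u in `[s, t]) (poisson_kernel v (u - c))%:E =
   (atan ((t - c) / v) - atan ((s - c) / v))%:E)%E.
Proof.
move=> v0 st.
apply: (@FTC_is_derive _ (fun u => atan ((u - c) / v)) (fun u => poisson_kernel v (u - c))) => // x.
  exact: is_derive_atan_poisson.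
apply: (@continuous_comp _ _ _ (fun x => x - c) (poisson_kernel v)).
  by apply: cvgB; [exact: cvg_id|exact: cvg_cst].
exact: continuous_poisson_kernel.
Qed.

Lemma Im_cpow1 p (u v : R) :
  complex.Im (cpow p 1 (u +i* v)) = \int[p]_x poisson_kernel v (u - x).
Proof.
rewrite /cpow /cint /=; apply: eq_Rintegral => x _.
rewrite sub0r sqrrN mulNr opprK.
by rewrite /poisson_kernel -(sqrrN (x - u)) opprB.
Qed.

(** Imaginary parts at height [v]: smoothing by width [v] yields a kernel of width [v + b] centred
    at [a]. The value [b = 0] is the Dirac case. *)
Lemma stieltjes_poisson p (a b : R) : 0 <= b ->
  (forall z, 0 < complex.Im z -> cpow p 1 z = (a -i* b - z)^-1) ->
  forall u v, 0 < v -> \int[p]_x poisson_kernel v (u - x) = poisson_kernel (v + b) (u - a).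
Proof.
move=> b0 H u v v0; rewrite -Im_cpow1 H//.
rewrite /= -opprD sqrrN mulNr opprK.
by rewrite /poisson_kernel [v + b]addrC -(sqrrN (a - u)) opprB.
Qed.

Lemma measurable_kernel_shift v : 0 < v ->
  measurable_fun setT (fun z : TR * TR => poisson_kernel v ((z.2 : R) - (z.1 : R))).
Proof.
move=> v0.
have m1 : measurable_fun setT (fun z : TR * TR => z.1 : R) by exact: measurable_fst.
have m2 : measurable_fun setT (fun z : TR * TR => z.2 : R) by exact: measurable_snd.
exact: (measurableT_comp (measurable_poisson_kernel v0) (measurable_funB m2 m1)).
Qed.

Lemma poisson_kernel_le v t : 0 < v -> `|poisson_kernel v t| <= v^-1.
Proof.
move=> v0; rewrite ger0_norm; last exact/poisson_kernel_ge0/ltW.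
rewrite /poisson_kernel ler_pdivrMr ?ltr_wpDl ?sqr_ge0 ?exprn_gt0//.
by rewrite mulrDr expr2 [v ^+ 2]expr2 mulKf ?gt_eqF// lerDr mulr_ge0 ?sqr_ge0// invr_ge0 ltW.
Qed.

(** Integrate the previous identity over [u] in [[s, t]] and exchange by Tonelli; [atan] is a
    primitive of the kernel. *)
Lemma integral_atan_poisson p (a b : R) : 0 <= b ->
  (forall z, 0 < complex.Im z -> cpow p 1 z = (a -i* b - z)^-1) ->
  forall s t v : R, s < t -> 0 < v ->
  \int[p]_x (atan ((t - x) / v) - atan ((s - x) / v)) =
  atan ((t - a) / (v + b)) - atan ((s - a) / (v + b)).
Proof.
move=> b0 H s t v st v0.
have vb : 0 < v + b by rewrite ltr_wpDr.
pose f (z : TR * TR) :=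
  (poisson_kernel v ((z.2 : R) - (z.1 : R)) * \1_(`[s, t]%classic) (z.2 : R))%:E.
have mf : measurable_fun setT f.
  apply/measurable_EFinP; apply: measurable_funM; first exact: measurable_kernel_shift.
  apply: (measurableT_comp _ measurable_snd).
  exact: measurable_indic.
have f0 z : (0 <= f z)%E.
  by rewrite lee_fin mulr_ge0// poisson_kernel_ge0// ltW.
have := fubini_tonelli (m1 := p) (m2 := mu) f mf f0.
have -> : (\int[p]_x \int[mu]_y f (x, y) =
    \int[p]_x (atan ((t - x) / v) - atan ((s - x) / v))%:E)%E.
  apply: eq_integral => x _; rewrite -integral_poisson_kernel// [RHS]integral_mkcond.
  apply: eq_integral => u _; rewrite /f /= patchE indicE.
  by case: ifPn => _; rewrite ?mulr1 ?mulr0.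
have -> : (\int[mu]_y \int[p]_x f (x, y) =
    (atan ((t - a) / (v + b)) - atan ((s - a) / (v + b)))%:E)%E.
  rewrite -integral_poisson_kernel// [RHS]integral_mkcond.
  apply: eq_integral => u _; rewrite /f /= patchE indicE.
  case: ifPn => _; last by under eq_integral do rewrite mulr0; rewrite integral0.
  under eq_integral do rewrite mulr1.
  rewrite -(stieltjes_poisson b0 H u v0) /Rintegral fineK//.
  apply: integrable_fin_num => //.
  apply: (@bounded_integrable _ _ _ p (fun x => poisson_kernel v (u - x)) v^-1).
    have m1 : measurable_fun setT (fun x : TR => u - (x : R)).
      by apply: measurable_funB; [exact: measurable_cst|exact: measurable_id].
    exact: (measurableT_comp (measurable_poisson_kernel v0) m1).
  by move=> x; exact: poisson_kernel_le.
by rewrite /Rintegral => ->.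
Qed.

Lemma cvg_atan_sg (y : R) :
  atan (y / j.+1%:R^-1) @[j --> \oo] --> pi / 2 * Num.sg y.
Proof.
have pos (x : R) : 0 < x -> atan (x / j.+1%:R^-1) @[j --> \oo] --> pi / 2.
  move=> x0; apply: (@cvg_comp _ _ _ (fun j : nat => x / j.+1%:R^-1) atan _ _ _ _ (@cvgy_atan R)).
  apply/cvgryPge => A; near=> j; rewrite invrK mulrC -ler_pdivrMr//.
  by rewrite (@le_trans _ _ j%:R)// ?ler_nat//; near: j; exact: nbhs_infty_ger.
have [y0|y0|->] := ltrgt0P y.
- by rewrite gtr0_sg// mulr1; exact: pos.
- rewrite ltr0_sg// mulrN1.
  have -> : (fun j : nat => atan (y / j.+1%:R^-1)) = (fun j : nat => - atan ((- y) / j.+1%:R^-1)).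
    by apply/funext => j; rewrite mulNr atanN opprK.
  by apply: cvgN; apply: pos; rewrite oppr_gt0.
- rewrite sgr0 mulr0; under eq_fun do rewrite mul0r atan0.
  exact: cvg_cst.
Unshelve. all: by end_near. Qed.

Lemma measurable_sg_shift (t : R) :
  measurable_fun setT (fun x : TR => pi / 2 * Num.sg (t - (x : R)) : R).
Proof.
have m1 : measurable_fun setT (fun x : TR => t - (x : R)).
  by apply: measurable_funB; [exact: measurable_cst|exact: measurable_id].
have ma : measurable_fun [set: R] (@atan R).
  by apply: continuous_measurable_fun => x; exact: continuous_atan.
apply: (measurable_fun_cvg (fun j => _)) => [j|x _]; last exact: cvg_atan_sg.
apply: (measurableT_comp ma); apply: measurable_funM => //; exact: measurable_cst.
Qed.

Lemma atan_bound (x y : R) : `|atan x - atan y| <= pi.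
Proof.
have := atan_gtNpi2 x; have := atan_ltpi2 x; have := atan_gtNpi2 y; have := atan_ltpi2 y.
by move=> *; rewrite ler_norml; apply/andP; split; lra.
Qed.

(** Stieltjes-Perron inversion: let the width [v = 1 / (j + 1)] tend to [0]. On the right this needs
    [b] nonzero for continuity. *)
Lemma integral_sg_poisson p (a b : R) : 0 < b ->
  (forall z, 0 < complex.Im z -> cpow p 1 z = (a -i* b - z)^-1) ->
  forall s t : R, s < t ->
  \int[p]_x (pi / 2 * Num.sg (t - x) - pi / 2 * Num.sg (s - x)) =
  atan ((t - a) / b) - atan ((s - a) / b).
Proof.
move=> b0 H s t st.
have ma : measurable_fun [set: R] (@atan R).
  by apply: continuous_measurable_fun => x; exact: continuous_atan.
have mat (c : R) (j : nat) : measurable_fun setT (fun x : TR => atan ((c - (x : R)) / j.+1%:R^-1)).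
  have m1 : measurable_fun setT (fun x : TR => c - (x : R)).
    by apply: measurable_funB; [exact: measurable_cst|exact: measurable_id].
  by apply: (measurableT_comp ma); apply: measurable_funM => //; exact: measurable_cst.
have c1 : \int[p]_x (atan ((t - x) / j.+1%:R^-1) - atan ((s - x) / j.+1%:R^-1))
    @[j --> \oo] --> \int[p]_x (pi / 2 * Num.sg (t - x) - pi / 2 * Num.sg (s - x)).
  apply: (@Rintegral_dominated_cvg _ _ _ p _ _ pi).
  - by move=> j; exact: measurable_funB (mat t j) (mat s j).
  - exact: measurable_funB (measurable_sg_shift t) (measurable_sg_shift s).
  - by move=> j x; exact: atan_bound.
  - by apply: aeW => x; apply: cvgB; exact: cvg_atan_sg.
have c2 : atan ((t - a) / (j.+1%:R^-1 + b)) - atan ((s - a) / (j.+1%:R^-1 + b))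
    @[j --> \oo] --> atan ((t - a) / b) - atan ((s - a) / b).
  have L (c : R) : atan ((c - a) / (j.+1%:R^-1 + b)) @[j --> \oo] --> atan ((c - a) / b).
    apply: continuous_cvg; first exact: continuous_atan.
    apply: cvgM; first exact: cvg_cst.
    apply: cvgV; first by rewrite gt_eqF.
    rewrite -[X in _ --> X]add0r; apply: cvgD; [exact: cvg_harmonic|exact: cvg_cst].
  by apply: cvgB; exact: L.
have E (j : nat) : \int[p]_x (atan ((t - x) / j.+1%:R^-1) - atan ((s - x) / j.+1%:R^-1)) =
    atan ((t - a) / (j.+1%:R^-1 + b)) - atan ((s - a) / (j.+1%:R^-1 + b)).
  by apply: integral_atan_poisson => //; rewrite ?invr_gt0// ltW.
move: c1; rewrite (funext E) => c1.
exact: cvg_unique c1 c2.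
Qed.

(** The limiting integrand equals [pi] inside the interval, [pi / 2] at its endpoints and [0]
    outside, so it lies between the two multiples of indicators whatever the atoms at [s] and
    [t]. *)
Lemma poisson_sandwich p (a b : R) : 0 < b ->
  (forall z, 0 < complex.Im z -> cpow p 1 z = (a -i* b - z)^-1) ->
  forall s t : R, s < t ->
  pi * fine (p `]s, t[%classic) <= atan ((t - a) / b) - atan ((s - a) / b) /\
  atan ((t - a) / b) - atan ((s - a) / b) <= pi * fine (p `[s, t]%classic).
Proof.
move=> b0 H s t st; rewrite -(integral_sg_poisson b0 H st).
have I (A : set TR) : measurable A -> pi * fine (p A) = \int[p]_x (pi * \1_A x).
  move=> mA; rewrite RintegralZl//; last first.
    apply: (@bounded_integrable _ _ _ p (\1_A : TR -> R) 1); first exact: measurable_indic.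
    by move=> x; rewrite indicE; case: (_ \in _); rewrite ?normr1 ?normr0.
  by rewrite /Rintegral integral_indic// setIT.
have iI (A : set TR) : measurable A -> p.-integrable setT (EFin \o (fun x => pi * \1_A x : R)).
  move=> mA; apply: (@bounded_integrable _ _ _ p _ pi).
    by apply: measurable_funM; [exact: measurable_cst|exact: measurable_indic].
  move=> x; rewrite indicE ger0_norm ?mulr_ge0 ?pi_ge0//.
  by case: (_ \in _); rewrite ?mulr1 ?mulr0 ?pi_ge0.
have iJ : p.-integrable setT (EFin \o (fun x : TR =>
    pi / 2 * Num.sg (t - (x : R)) - pi / 2 * Num.sg (s - (x : R)))).
  apply: (@bounded_integrable _ _ _ p _ pi).
    exact: measurable_funB (measurable_sg_shift t) (measurable_sg_shift s).
  have := pi_gt0 R => pi0 x.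
  rewrite ler_norml.
  by case: (sgrP (t - x)) => _; case: (sgrP (s - x)) => _; apply/andP; split; lra.
have pi0 := pi_gt0 R.
split.
- rewrite I//; apply: le_Rintegral => //; first exact: iI.
  move=> x _; rewrite indicE mem_setE in_itv /=.
  case: (ltP s x) => sx; case: (ltP x t) => xt /=; rewrite ?mulr1 ?mulr0.
  + by rewrite gtr0_sg ?subr_gt0// ltr0_sg ?subr_lt0//; lra.
  + rewrite [Num.sg (s - x)]ltr0_sg ?subr_lt0//.
    by case: (sgrP (t - x)) => _; lra.
  + rewrite [Num.sg (t - x)]gtr0_sg ?subr_gt0//.
    by case: (sgrP (s - x)) => _; lra.
  + by have := lt_le_trans st xt; rewrite ltNge sx.
- rewrite I//; apply: le_Rintegral => //; first exact: iI.
  move=> x _; rewrite indicE mem_setE in_itv /=.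
  case: (leP s x) => sx; case: (leP x t) => xt /=; rewrite ?mulr1 ?mulr0.
  + by case: (sgrP (t - x)) => _; case: (sgrP (s - x)) => _; lra.
  + by rewrite !ltr0_sg ?subr_lt0//; [lra|exact: lt_trans xt].
  + by rewrite !gtr0_sg ?subr_gt0//; [lra|exact: lt_trans st].
  + by have := lt_trans (lt_trans st xt) sx; rewrite ltxx.
Qed.

(** Bundles the candidate law as a measure, to which uniqueness on half-open intervals applies. *)
Lemma density_measure (f : R -> R) : (forall x, 0 <= f x) -> measurable_fun setT f ->
  exists m : {measure set TR -> \bar R}, forall A, m A = (\int[mu]_(x in A) (f x)%:E)%E.
Proof.
move=> f0 mf.
pose m (A : set TR) := (\int[mu]_(x in A) (f x)%:E)%E.
have m0 : m set0 = 0%E by exact: integral_set0.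
have mge0 A : (0 <= m A)%E by apply: integral_ge0 => x _; rewrite lee_fin.
have madd : semi_sigma_additive m.
  move=> F mF tF mUF; rewrite /m ge0_integral_bigcup//.
  - apply: is_cvg_ereal_nneg_natsum_cond => n _ _; exact: mge0.
  - by apply: measurable_funTS; exact/measurable_EFinP.
  - by move=> x _; rewrite lee_fin.
pose M : {measure set TR -> \bar R} := HB.pack m (isMeasure.Build _ _ _ m m0 mge0 madd).
by exists M.
Qed.

Lemma probability_ocitv_unique p (m : {measure set TR -> \bar R}) :
  (forall s t : R, s < t -> p `]s, t]%classic = m `]s, t]%classic) ->
  forall A, measurable A -> p A = m A.
Proof.
move=> H A mA.
apply: (@measure_unique _ R TR (@ocitv R) (fun n : nat => `](1 *- n : R), n%:R]%classic)) => //.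
- exact: ocitvI.
- by move=> n; exact: is_ocitv.
- exact: bigcup_itvT.
- by move=> X /ocitvP[->|[[s t] /= st ->]]; [rewrite !measure0|exact: H].
- by move=> n; apply: le_lt_trans (ltry 1); exact: probability_le1.
Qed.

Lemma stieltjes_is_cauchy p (a b : R) : 0 < b ->
  (forall z, 0 < complex.Im z -> cpow p 1 z = (a -i* b - z)^-1) -> is_cauchy p.
Proof.
move=> b0 H; exists a, b; split => //.
pose f (x : R) := pi^-1 * (b / ((x - a) ^+ 2 + b ^+ 2)).
have pi0 := pi_gt0 R.
have f0 x : 0 <= f x.
  by rewrite mulr_ge0 ?invr_ge0 ?(ltW pi0)//; exact/poisson_kernel_ge0/ltW.
have mk : measurable_fun [set: R] (fun x : R => poisson_kernel b (x - a)).
  apply: (measurableT_comp (measurable_poisson_kernel b0)).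
  by apply: measurable_funB; [exact: measurable_id|exact: measurable_cst].
have mf : measurable_fun setT f by apply: measurable_funM => //; exact: measurable_cst.
have [m mE] := density_measure f0 mf.
move=> A mA; rewrite -/f -mE; apply: probability_ocitv_unique mA => s t st.
pose G (x : R) := atan ((x - a) / b).
have -> : m `]s, t]%classic = (pi^-1 * (G t - G s))%:E.
  rewrite mE integral_itv_obnd_cbnd; last first.
    by apply: measurable_funTS; exact/measurable_EFinP.
  rewrite EFinM -integral_poisson_kernel//.
  rewrite -ge0_integralZl//.
  - by apply: measurable_funTS; exact/measurable_EFinP.
  - by move=> x _; rewrite lee_fin; exact/poisson_kernel_ge0/ltW.
  - by rewrite lee_fin invr_ge0 ltW.
rewrite -[LHS]fineK ?fin_num_measure//; congr (_%:E).
apply: (mulfI (lt0r_neq0 pi0)); rewrite mulVKf ?lt0r_neq0//.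
have LG (u : R) : G (u + j.+1%:R^-1) @[j --> \oo] --> G u.
  rewrite /G; apply: continuous_cvg; first exact: continuous_atan.
  apply: cvgM; last exact: cvg_cst.
  apply: cvgB; last exact: cvg_cst.
  by rewrite -[X in _ --> X]addr0; apply: cvgD; [exact: cvg_cst|exact: cvg_harmonic].
(* []s, t]] is contained in []s, t + 1/(j+1)[] and contains [[s + 1/(j+1), t]]; each half of the
   sandwich gives one inequality in the limit. *)
apply/eqP; rewrite eq_le; apply/andP; split.
- have L : G (t + j.+1%:R^-1) - G s @[j --> \oo] --> G t - G s.
    by apply: cvgB; [exact: LG|exact: cvg_cst].
  apply: (cvgr_to_ge L); apply: nearW => j.
  have stj : s < t + j.+1%:R^-1 by rewrite (lt_le_trans st)// lerDl invr_ge0.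
  apply: le_trans (poisson_sandwich b0 H stj).1.
  rewrite ler_pM2l// fine_le ?fin_num_measure//.
  apply: le_measure; rewrite ?inE//.
  by apply: subset_itvl; rewrite bnd_simp ltrDl invr_gt0 ltr0n.
- have L : G t - G (s + j.+1%:R^-1) @[j --> \oo] --> G t - G s.
    by apply: cvgB; [exact: cvg_cst|exact: LG].
  apply: (cvgr_to_le L); near=> j.
  have stj : s + j.+1%:R^-1 < t.
    rewrite -ltrBrDl; near: j.
    have ts : 0 < t - s by rewrite subr_gt0.
    exact: (near_infty_natSinv_lt (PosNum ts)).
  apply: le_trans (poisson_sandwich b0 H stj).2 _.
  rewrite ler_pM2l// fine_le ?fin_num_measure//.
  apply: le_measure; rewrite ?inE//.
  by apply: subset_itvr; rewrite bnd_simp ltrDl invr_gt0 ltr0n.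
Unshelve. all: by end_near. Qed.

(** The value at [z = a + i] suffices: the kernel of width [1] is at most [1], with equality only at
    [x = a], and its mean under [p] is [1]. *)
Lemma stieltjes_is_dirac p (a : R) :
  (forall z, 0 < complex.Im z -> cpow p 1 z = (a%:C - z)^-1) -> is_dirac p.
Proof.
move=> H; exists a.
have E1 : \int[p]_x poisson_kernel 1 (a - x) = 1.
  rewrite (@stieltjes_poisson p a 0)//; last by move=> z z0; rewrite H// oppr0.
  by rewrite /poisson_kernel addr0 subrr expr0n /= add0r expr1n divr1.
pose f (x : TR) : R := 1 - poisson_kernel 1 (a - (x : R)).
have mk : measurable_fun setT (fun x : TR => poisson_kernel 1 (a - (x : R))).
  have m1 : measurable_fun setT (fun x : TR => a - (x : R)).
    by apply: measurable_funB; [exact: measurable_cst|exact: measurable_id].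
  exact: (measurableT_comp (measurable_poisson_kernel ltr01) m1).
have mf : measurable_fun setT f by apply: measurable_funB => //; exact: measurable_cst.
have fE x : f x = (a - x) ^+ 2 / ((a - x) ^+ 2 + 1).
  have h : 0 < (a - (x : R)) ^+ 2 + 1 by rewrite ltr_wpDl// sqr_ge0.
  by rewrite /f /poisson_kernel expr1n; field; rewrite gt_eqF.
have f0 x : 0 <= f x by rewrite fE divr_ge0 ?addr_ge0 ?sqr_ge0.
have ik : p.-integrable setT (EFin \o (fun x : TR => poisson_kernel 1 (a - (x : R)))).
  by apply: (@bounded_integrable _ _ _ p _ 1^-1) => // x; exact: poisson_kernel_le.
have i1 : p.-integrable setT (EFin \o (fun=> 1 : R)).
  by apply: (@bounded_integrable _ _ _ p _ `|1|).
have if0 : \int[p]_x f x = 0.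
  rewrite /f RintegralB// E1 Rintegral_cst//= probability_setT mulr1 subrr//.
have ae0 : ae_eq p setT (EFin \o f) (cst 0%E).
  apply/ae_eq_integral_abs => //; first exact/measurable_EFinP.
  under eq_integral do rewrite /= ger0_norm//.
  rewrite -[LHS]fineK; last first.
    by apply: integrable_fin_num => //; exact: (integrableB measurableT i1 ik).
  by congr (_%:E).
have pa : p (~` [set a]) = 0%E.
  have [N [mN N0 sN]] := ae0.
  apply/eqP; rewrite eq_le measure_ge0 andbT -N0; apply: le_measure; rewrite ?inE//.
    exact: measurableC.
  move=> x xa; apply: sN => /= /(_ I)[] /eqP; rewrite fE mulf_eq0 invr_eq0.
  rewrite (gt_eqF (_ : 0 < (a - x) ^+ 2 + 1)) ?ltr_wpDl ?sqr_ge0// orbF sqrf_eq0 subr_eq0.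
  by move=> /eqP ax; apply: xa.
have pa1 : p [set a] = 1%E.
  by rewrite -(setCK [set a]) probability_setC ?pa ?sube0//; exact: measurableC.
move=> A mA; rewrite diracE; case: (boolP (a \in A)) => [/set_mem aA|/negP aA].
  apply/eqP; rewrite eq_le probability_le1//= -pa1; apply: le_measure; rewrite ?inE//.
  by move=> _ ->.
apply/eqP; rewrite eq_le measure_ge0 andbT -[leRHS]/(0%E : \bar R) -pa.
apply: le_measure; rewrite ?inE//; first exact: measurableC.
by move=> x Ax xa; apply: aA; rewrite inE -xa.
Qed.

End CauchyDirac.

Lemma is_mu_cpow (R : realType) (n : nat)
    (alpha nu : probability (measurableTypeR R) R) (z : R[i]) :
  is_mu n.+1%:R alpha nu -> 0 < complex.Im z ->
  cpow nu n.+2 z = cpow nu n.+1 z * cpow alpha 1 z.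
Proof.
case=> dO [T [P [B [Y [X [indep lawB lawY cvX nuE]]]]]].
have lawB' k A : measurable A -> P (B k @^-1` A) = alpha A by exact: lawB.
(* Having a common density, all the [Y k] share the law of [Y 0], which serves as [pY]. *)
have lawY' k A : measurable A -> P (Y k @^-1` A) = distribution P (Y 0%N) A.
  by move=> mA; rewrite lawY// -[LHS]/(distribution P (Y k) A) lawY.
exact: (@markov_krein _ T R P (fun k => B k) (fun k => Y k)
  (fun k => @measurable_funPT _ _ _ _ (B k)) (fun k => @measurable_funPT _ _ _ _ (Y k))
  indep alpha (distribution P (Y 0%N)) lawB' lawY' n (lawY 0%N) nu X z
  (@measurable_funPT _ _ _ _ X) cvX nuE).
Qed.

Theorem proposition6p2 (R : realType)
    (alpha mun mum : probability (measurableTypeR R) R) (n m : nat)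
    (halpha : FT1 alpha) (hn : (0 < n)%N) (hnm : (n < m)%N)
    (hmun : is_mu n%:R alpha mun) (hmum : is_mu m%:R alpha mum)
    (heq : eq_prob mun mum) :
  (forall z : R[i], 0 < complex.Im z ->
     (cderive n.-1 (stieltjes mun) z / (n.-1)`!%:R) ^+ m =
     (cderive m.-1 (stieltjes mun) z / (m.-1)`!%:R) ^+ n) /\
  (m = n.+1 \/ m = n.+2 -> is_cauchy alpha \/ is_dirac alpha).
Proof.
have Hn z : 0 < complex.Im z -> cpow mun n.+1 z = cpow mun n z * cpow alpha 1 z.
  by case: n hn hmun {hnm} => // n' _ hmu; exact: is_mu_cpow.
have Hm z : 0 < complex.Im z -> cpow mun m.+1 z = cpow mun m z * cpow alpha 1 z.
  (* The equality of the two laws enters here: the relation at [m] is carried over to [mun]. *)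
  have E k : cpow mun k z = cpow mum k z by exact: cint_eq_measure.
  by rewrite !E; case: m hmum hnm => // m' hmu _; exact: is_mu_cpow.
have D k z : 0 < complex.Im z -> (0 < k)%N ->
    cderive k.-1 (stieltjes mun) z / (k.-1)`!%:R = cpow mun k z.
  move=> z0; case: k => // k _; rewrite cderive_stieltjes//= mulrC mulKf//.
split=> [z z0|mn].
  by rewrite !D// ?(ltn_trans hn)//; exact: (cpow_power_relation Hn Hm).
have sqr z : 0 < complex.Im z -> cpow alpha 2 z = cpow alpha 1 z ^+ 2.
  move: z; case: mn Hm => -> Hm; first exact: stieltjes_sqr_succ Hn Hm.
  exact: stieltjes_sqr_succ2 Hn Hm.
have [[a b] [/= b0 H]] := stieltjes_of_sqr sqr.
(* [c = a + i b] with [b <= 0]: zero gives the point mass at [a], otherwise [- b] is the Cauchy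
   scale. *)
move: b0; rewrite le_eqVlt => /predU1P[b0|b0].
  by right; apply: (@stieltjes_is_dirac _ _ a) => z z0; rewrite H// b0.
left; apply: (@stieltjes_is_cauchy _ _ a (- b)); first by rewrite oppr_gt0.
by move=> z z0; rewrite H// opprK.
Qed.
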